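(* Let $(\Omega,\mathcal F,\mathbb P)$ be an atomless probability space, let $p\in(0,1)$ and let $\rho: L^\infty\to(-\infty,\infty]$. Put $\mathbb H=\{(x,y)\in\mathbb R^2: x\ge y\}$. Then: (i) $\rho$ satisfies [$p$-CA] if and only if there is a function $f:\mathbb H\to(-\infty,\infty]$, increasing in its first argument, such that $\rho(X)=f(\mathrm{ES}_p(X),\mathbb E[X])$ for all $X\in L^\infty$. (ii) $\rho$ satisfies [M] and [$p$-CA] if and only if there is a function $f:\mathbb H\to(-\infty,\infty]$, increasing in both arguments, such that $\rho(X)=f(\mathrm{ES}_p(X),\mathbb E[X])$ for all $X\in L^\infty$.
   Context: $(\Omega,\mathcal F,\mathbb P)$ is atomless; $L^\infty=L^\infty(\Omega,\mathcal F,\mathbb P)$ is the space of essentially bounded random variables (positive values represent losses). Equalities and inequalities between random variables are understood $\mathbb P$-a.s. unless said to be pointwise. ''Increasing'' means non-strictly increasing. $X\overset{d}{=}Y$ means equality in law. For $p\in(0,1)$, $\mathrm{VaR}_p(X)=\inf\{x\in\mathbb R:\mathbb P(X\le x)\ge p\}$ and $\mathrm{ES}_p(X)=\frac1{1-p}\int_p^1\mathrm{VaR}_s(X)\,ds$. A tail event of a random variable $X$ is an event $A\in\mathcal F$ with $0<\mathbb P(A)<1$ such that $X(\omega)\ge X(\omega')$ for a.s. all $\omega\in A$ and $\omega'\in A^c$. A $p$-tail event of $X$ is a tail event of $X$ with probability $1-p$. A random vector is $p$-concentrated if its components share a common $p$-tail event. [M] (monotonicity): $\rho(X)\le\rho(Y)$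 whenever $X\le Y$ pointwise. [$p$-CA] ($p$-concentration aversion): $\rho(X+Y)\le\rho(X'+Y')$ for all $X,Y,X',Y'$ in the domain of $\rho$ such that $(X',Y')$ is $p$-concentrated, $X\overset{d}{=}X'$ and $Y\overset{d}{=}Y'$. *)

(* Defs.v *)
From HB Require Import structures.
From mathcomp Require Import all_boot all_order all_algebra.
From mathcomp Require Import all_classical all_reals all_analysis.

Set Implicit Arguments.
Unset Strict Implicit.
Unset Printing Implicit Defensive.

Import Order.TTheory GRing.Theory Num.Theory.
Import numFieldNormedType.Exports.

Local Open Scope classical_set_scope.
Local Open Scope ring_scope.

Section defs.
Context d (T : measurableType d) (R : realType) (P : probability T R).

Definition atomless := forall A : set T, measurable A -> (0 < P A)%E ->
  exists B : set T, [/\ measurable B, B `<=` A, (0 < P B)%E & (P B < P A)%E].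

(** Elements are functions on [T], not classes modulo almost sure equality, so
    that the pointwise order makes sense. *)
Definition Linfty := LfunType P (leey 1%E : (1 <= +oo)%E).

Implicit Types X Y : {RV P >-> R}.

(** For [0 < s < 1] the set below is nonempty and bounded below; [inf] takes a
    junk value for other [s]. *)
Definition VaR (s : R) X : R := inf [set x : R | (s%:E <= cdf X x)%E].

Definition ES (p : R) X : R :=
  (1 - p)^-1 * \int[lebesgue_measure]_(s in `]p, 1[) VaR s X.

(** "For a.s. all [w] in [A] and [w'] outside [A]" allows one exceptional null
    set [N], removed from both [A] and its complement. *)
Definition tail_event X (A : set T) := [/\ measurable A, (0 < P A < 1)%E &
  exists2 N : set T, P.-negligible N &
    forall w w', A w -> ~ A w' -> ~ N w -> ~ N w' -> X w' <= X w].

Definition p_tail_event (p : R) X (A : set T) :=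
  tail_event X A /\ P A = (1 - p)%:E.

Definition p_concentrated (p : R) X Y :=
  exists A : set T, p_tail_event p X A /\ p_tail_event p Y A.

(** Restricted to measurable [B]: measures take unspecified values elsewhere. *)
Definition eq_in_law X Y :=
  forall B : set R, measurable B -> distribution P X B = distribution P Y B.

Definition monotonicity (rho : Linfty -> \bar R) :=
  forall X Y : Linfty, (forall w, X w <= Y w) -> (rho X <= rho Y)%E.

Definition p_concentration_aversion (p : R) (rho : Linfty -> \bar R) :=
  forall X Y X' Y' : Linfty, p_concentrated p X' Y' ->
    eq_in_law X X' -> eq_in_law Y Y' ->
    (rho (X + Y)%R <= rho (X' + Y')%R)%E.

End defs.

(** [{RV P >-> R}] unfolds to a type in which [P] does not occur, so [P] cannot be
    inferred from a random variable. *)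
Arguments VaR {d T R} P s X.
Arguments ES {d T R} P p X.
Arguments tail_event {d T R} P X A.
Arguments p_tail_event {d T R} P p X A.
Arguments p_concentrated {d T R} P p X Y.
Arguments eq_in_law {d T R} P X Y.

(** A function from the half-plane [x >= y] to [(-oo, +oo]] is encoded as a total
    [f : R -> R -> \bar R], constrained only on that half-plane. *)
Section halfplane.
Context (R : realType).
Implicit Types f : R -> R -> \bar R.

Definition gtNy_on_halfplane f := forall x y, y <= x -> (-oo < f x y)%E.

Definition increasing_in_first f :=
  forall x x' y, y <= x -> x <= x' -> (f x y <= f x' y)%E.

Definition increasing_in_second f :=
  forall x y y', y <= y' -> y' <= x -> (f x y <= f x y')%E.

End halfplane.

(** [fine] is harmless: essentially bounded variables have finite expectation. *)
Definition represented_by d (T : measurableType d) (R : realType)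
    (P : probability T R) (p : R) (rho : Linfty P -> \bar R)
    (f : R -> R -> \bar R) :=
  forall X : Linfty P, rho X = f (ES P p X) (fine ('E_P[X])%E).

(* Main.v *)
(** Taking [Y = 0], [p]-concentration aversion forces law invariance; and when [X] and
    [Y] share a tail event, [rho (X + Y)] depends only on the laws of [X] and [Y].

    The heart of the matter is that [rho X] is unchanged when [X], with tail event [A], is
    replaced by its conditional means on [A] and on its complement. On each piece, the
    centred variable [D] has the law of the increments of a bounded stationary sequence
    [Z]: draw a positive value [a] and a nonpositive value [- b] of [D] independently,
    with a size bias proportional to [a + b], draw [Z_0] uniformly in [[0, a + b[] and let
    [Z_(j+1) = Z_j + a] modulo [a + b]. An atomless space carries a copy of this sequence,
    built bit by bit from nested events of prescribed probabilities. Averaging the [n]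
    rearrangements [X_j = mean + Z_(j+1) - Z_j] of [X] leaves [rho] unchanged and telescopes
    to [(mean - Z_0 / n) + Z_n / n]. If the two conditional means differ, [A] is a tail
    event of both summands as soon as [n] is large, so [Z_n] may be replaced by [Z_0].

    Hence [rho X] is a function of the mean of [X] over a [p]-tail event, which is [ES],
    and of the mean of [X]. This function increases with [ES], as one sees by spreading a
    two-valued variable over two events. Conversely, [ES] is law invariant, subadditive,
    and additive on [p]-concentrated pairs. *)

Require Import Defs.
From HB Require Import structures.
From mathcomp Require Import all_boot all_order all_algebra.
From mathcomp Require Import all_classical all_reals all_analysis.
From mathcomp Require Import measurable_realfun ess_sup_inf.
From mathcomp Require Import ring lra.
Import Order.TTheory GRing.Theory Num.Theory.
Import numFieldNormedType.Exports.
Local Open Scope classical_set_scope.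
Local Open Scope ring_scope.

Set Implicit Arguments.
Unset Strict Implicit.

(** No continuity of [rho] is available, so averages of rearrangements that merely converge to the
    conditional means prove nothing: the error has to be one that concentration aversion itself can
    absorb. Writing the centred variable as a coboundary achieves this, since the error
    [(Z_n - Z_0) / n] consists of two terms of equal law, exchanged in one move at a finite [n].

    The size bias comes from the rotation: given [a] and [b], the jump [a] happens with probability
    [b / (a + b)] and the jump [- b] with probability [a / (a + b)]. The weight [a + b] cancels the
    denominators, and the partner value left over integrates to the same constant for both signs,
    because the variable is centred. *)

Lemma measurable_set_le d (T : measurableType d) (R : realType) (f : T -> R) x :
  measurable_fun setT f -> measurable [set w | f w <= x].
Proof.
move=> mf; rewrite (_ : [set _ | _] = f @^-1` `]-oo, x]).
  by rewrite -[X in measurable X]setTI; exact: mf.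
by apply/seteqP; split => w /=; rewrite in_itv/=.
Qed.

Lemma measurable_set_lt d (T : measurableType d) (R : realType) (f : T -> R) x :
  measurable_fun setT f -> measurable [set w | f w < x].
Proof.
move=> mf; rewrite (_ : [set _ | _] = f @^-1` `]-oo, x[).
  by rewrite -[X in measurable X]setTI; exact: mf.
by apply/seteqP; split => w /=; rewrite in_itv/=.
Qed.

Lemma measurable_set_gt d (T : measurableType d) (R : realType) (f : T -> R) x :
  measurable_fun setT f -> measurable [set w | x < f w].
Proof.
move=> mf; rewrite (_ : [set _ | _] = ~` [set w | f w <= x]).
  by apply: measurableC; exact: measurable_set_le.
by apply/seteqP; split => w /=; rewrite ltNge => /negP.
Qed.

(** Real-valued, so that linear arithmetic applies to probabilities. *)
Definition pr d (T : measurableType d) (R : realType) (P : probability T R)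
  (A : set T) : R := fine (P A).

Section pr.
Context d (T : measurableType d) (R : realType) (P : probability T R).
Implicit Types A B : set T.

Lemma prE A : measurable A -> P A = (pr P A)%:E.
Proof. by move=> mA; rewrite /pr fineK// fin_num_measure. Qed.

Lemma pr_ge0 A : 0 <= pr P A.
Proof. exact: fine_ge0. Qed.

Lemma pr0 : pr P set0 = 0.
Proof. by rewrite /pr measure0. Qed.

Lemma prT : pr P setT = 1.
Proof. by rewrite /pr probability_setT. Qed.

Lemma pr_le A B : measurable A -> measurable B -> A `<=` B -> pr P A <= pr P B.
Proof.
by move=> mA mB AB; rewrite -lee_fin -!prE//; apply: le_measure; rewrite ?inE.
Qed.

Lemma prU A B : measurable A -> measurable B -> A `&` B = set0 ->
  pr P (A `|` B) = pr P A + pr P B.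
Proof.
move=> mA mB AB; apply: EFin_inj; rewrite EFinD -!prE//; last exact: measurableU.
exact: measureU.
Qed.

Lemma prDI A B : measurable A -> measurable B ->
  pr P A = pr P (A `&` B) + pr P (A `\` B).
Proof.
move=> mA mB; rewrite -prU ?setUIDK//; first exact: measurableI.
  exact: measurableD.
by rewrite setDE setIACA setICr setI0.
Qed.

Lemma prD A B : measurable A -> measurable B -> B `<=` A ->
  pr P (A `\` B) = pr P A - pr P B.
Proof.
move=> mA mB BA; rewrite (prDI mA mB) setIC.
by rewrite (setIidl BA) addrAC subrr add0r.
Qed.

Lemma pr_setC A : measurable A -> pr P (~` A) = 1 - pr P A.
Proof. by move=> mA; rewrite -setTD prD// prT. Qed.

End pr.

(** * Atomless probability spaces *)

Section atomless.
Context d (T : measurableType d) (R : realType) (P : probability T R).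
Hypothesis P_atomless : atomless P.
Implicit Types A B : set T.

(** A subset of strictly smaller mass and its complement in [A] share the mass of [A], so one of
    them has at most half of it. *)
Lemma atomless_half A : measurable A -> 0 < pr P A ->
  exists B, [/\ measurable B, B `<=` A, 0 < pr P B & pr P B <= pr P A / 2].
Proof.
move=> mA A0; have [|B [mB BA]] := P_atomless mA; first by rewrite prE// lte_fin.
rewrite !prE// !lte_fin => B0 BltA.
have := prD P mA mB BA.
have [BA2 _|BA2 DE] := leP (pr P B) (pr P A / 2); first by exists B.
by exists (A `\` B); split => //; [exact: measurableD|rewrite DE; lra|rewrite DE; lra].
Qed.

Lemma atomless_small A e : measurable A -> 0 < pr P A -> 0 < e ->
  exists B, [/\ measurable B, B `<=` A, 0 < pr P B & pr P B <= e].
Proof.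
move=> mA A0 e0.
have [n An] : exists n, pr P A / 2 ^+ n <= e.
  have [n ne] : exists n : nat, e^-1 < n%:R.
    by exists (Num.bound e^-1); apply: archi_boundP; rewrite invr_ge0 ltW.
  exists n; rewrite ler_pdivrMr ?exprn_gt0//.
  have : n%:R <= 2 ^+ n :> R by rewrite -natrX ler_nat ltnW// ltn_expl.
  have A1 : pr P A <= 1 by rewrite -(prT P) pr_le.
  move=> n2; apply: (le_trans A1).
  by rewrite mulrC -ler_pdivrMr// div1r (le_trans (ltW ne)).
suff [B [mB BA B0 Bn]] : exists B, [/\ measurable B, B `<=` A, 0 < pr P B &
    pr P B <= pr P A / 2 ^+ n].
  by exists B; split => //; exact: le_trans An.
elim: n {An} => [|n [B [mB BA B0 Bn]]]; first by exists A; split => //; rewrite expr0 divr1.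
have [C [mC CB C0 CB2]] := atomless_half mB B0.
exists C; split => //; first exact: subset_trans BA.
apply: (le_trans CB2); rewrite exprSr invfM mulrA ler_wpM2r ?invr_ge0//.
Qed.

(* Exhaustion: each step adds a set of at least half the largest mass that still fits
  below [c]. *)
Lemma atomless_subset A c : measurable A -> 0 <= c <= pr P A ->
  exists B, [/\ measurable B, B `<=` A & pr P B = c].
Proof.
move=> mA /andP[c0 cA].
pose good C := [/\ measurable C, C `<=` A & pr P C <= c].
have step (C : set T) : exists C', good C -> [/\ good C', C `<=` C' &
    forall D, measurable D -> D `<=` A `\` C -> pr P D <= c - pr P C ->
      pr P D <= 2 * (pr P C' - pr P C)].
  have [[mC CA Cc]|nC] := pselect (good C); last by exists C.
  pose S := [set pr P D | D in [set D | [/\ measurable D, D `<=` A `\` C &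
    pr P D <= c - pr P C]]].
  have S0 : S 0.
    by exists set0; [split => //; rewrite pr0 subr_ge0|rewrite pr0].
  have hS : has_sup S.
    split; first by exists 0.
    by exists (c - pr P C) => _ [D [_ _ ?] <-].
  have [s0|s0] := leP (sup S) 0.
    exists C => _; split => // D mD DAC Dc.
    rewrite subrr mulr0; apply: le_trans s0.
    by apply: ub_le_sup; [case: hS|exists D].
  have [_ [D [mD DAC Dc] <-] Ds] := @sup_adherent _ S (sup S / 2) (divr_gt0 s0 (ltr0n _
    2)) hS.
  have DU : pr P (C `|` D) = pr P C + pr P D.
    rewrite prU//; apply/seteqP; split => // x [Cx /DAC[_]]; exact.
  exists (C `|` D) => _; split.
  - split; [exact: measurableU| |by rewrite DU; lra].
    by move=> x [/CA//|/DAC[]].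
  - exact: subsetUl.
  - move=> E mE EAC Ec; have : pr P E <= sup S.
      by apply: ub_le_sup; [case: hS|exists E].
    by rewrite DU; lra.
have [next nextP] := choice step.
pose C n := iter n next set0.
have goodC n : good (C n).
  elim: n => [|n IH]; first by split; rewrite /C /= ?pr0;
    [exact: measurable0|exact: sub0set|].
  by have [] := nextP _ IH.
have CS n : C n `<=` C n.+1 by have [] := nextP _ (goodC n).
have mC n : measurable (C n) by case: (goodC n).
have mU : measurable (\bigcup_n C n) by exact: bigcup_measurable.
have UA : \bigcup_n C n `<=` A by apply: bigcup_sub => n _; case: (goodC n).
have Uc : pr P (\bigcup_n C n) <= c.
  have ndC : {homo C : n m / (n <= m)%N >-> (n <= m)%O}.
    by apply/nondecreasing_seqP => n; apply/subsetPset/CS.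
  rewrite -lee_fin -prE//.
  have cvgC := @nondecreasing_cvg_mu _ _ _ P C mC mU ndC.
  rewrite -(cvg_lim _ cvgC)//; apply: lime_le; first by apply/cvg_ex;
    exists (P (\bigcup_n C n)).
  by apply: nearW => n /=; rewrite prE// lee_fin; case: (goodC n).
exists (\bigcup_n C n); split => //; apply/eqP; rewrite eq_le Uc /= leNgt.
apply/negP => Ult.
have [|||D [mD DAU D0 Dc]] := @atomless_small (A `\` \bigcup_n C n) (c - pr P
  (\bigcup_n C n)).
- exact: measurableD.
- by rewrite prD// subr_gt0 (lt_le_trans Ult).
- by rewrite subr_gt0.
(* [D] fits at every stage, so every stage gains at least half of its mass; after [n.*2] stages the
   gain would be [n%:R * pr P D], which exceeds [c]. *)
have DC n : pr P D <= 2 * (pr P (C n.+1) - pr P (C n)).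
  have [_ _] := nextP _ (goodC n); apply => //.
    apply: (subset_trans DAU); apply: setDS; exact: bigcup_sup.
  apply: (le_trans Dc); rewrite lerD2l lerN2; apply: pr_le => //.
  exact: bigcup_sup.
have nD (n : nat) : n%:R * pr P D <= 2 * pr P (C n).
  elim: n => [|n IH]; first by rewrite mul0r mulr_ge0// pr_ge0.
  by have := DC n; rewrite -natr1; lra.
have := archi_boundP (divr_ge0 c0 (ltW D0)).
set n := Num.bound _.
have := nD n.*2; have [_ _ /[swap]] := goodC n.*2.
rewrite -muln2 natrM ltr_pdivrMr//; lra.
Qed.

End atomless.

(** Open right rays are stable under intersection and generate the Borel sets; finite total mass
    passes from left rays to them by complement. Two measures on two spaces are allowed because
    restrictions of [P] to an event and Lebesgue measure on the unit interval occur later. *)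
Lemma eq_law_rays d1 d2 (T1 : measurableType d1) (T2 : measurableType d2)
    (R : realType) (m1 : {measure set T1 -> \bar R})
    (m2 : {measure set T2 -> \bar R}) (f1 : T1 -> R) (f2 : T2 -> R) :
  measurable_fun setT f1 -> measurable_fun setT f2 ->
  (m1 setT < +oo)%E -> m1 setT = m2 setT ->
  (forall x, m1 (f1 @^-1` `]-oo, x]) = m2 (f2 @^-1` `]-oo, x])) ->
  forall B : set R, measurable B -> m1 (f1 @^-1` B) = m2 (f2 @^-1` B).
Proof.
move=> mf1 mf2 m1y m12 H B mB.
pose f1' : {mfun T1 >-> R} := mfun_Sub (mem_set mf1).
pose f2' : {mfun T2 >-> R} := mfun_Sub (mem_set mf2).
apply: (@measure_unique _ _ R (@measurable_realfun.RGenOInfty.G R) (fun k => `]- k%:R,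
  +oo[%classic)
  (measurable_realfun.RGenOInfty.measurableE R) _ _ _ (pushforward m1 f1') (pushforward
    m2 f2')) => //.
- move=> _ _ [x ->] [y ->]; exists (Order.max x y).
  by apply/seteqP; split => z /=; rewrite !in_itv/= !andbT gt_max => /andP.
- by move=> k; exists (- k%:R).
- apply/seteqP; split => // x _; exists (Num.bound `|x|) => //=.
  rewrite in_itv/= andbT ltrNl (le_lt_trans (ler_norm _))// normrN.
  exact: archi_boundP.
- move=> _ [x ->].
  have mr1 : measurable (f1 @^-1` `]-oo, x]).
    by rewrite -[X in measurable X]setTI; exact: (mf1 measurableT).
  have mr2 : measurable (f2 @^-1` `]-oo, x]).
    by rewrite -[X in measurable X]setTI; exact: (mf2 measurableT).
  have E (S : Type) (f : S -> R) :
      f @^-1` `]x, +oo[ = setT `\` f @^-1` `]-oo, x].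
    by rewrite -setCitvl setTD.
  change (m1 (f1 @^-1` `]x, +oo[) = m2 (f2 @^-1` `]x, +oo[)).
  rewrite !E [LHS]measureD//; rewrite [RHS]measureD//.
    by rewrite !setTI; congr (_ - _)%E; [exact: m12|exact: H].
  by move: m1y; rewrite m12.
- move=> k; apply: le_lt_trans m1y; rewrite /pushforward.
  apply: (@le_measure _ _ _ m1); rewrite ?inE//.
  by rewrite -[X in measurable X]setTI; exact: (mf1 measurableT).
Qed.

(** * Realizing joint laws on an atomless space *)

Section word.
Variable (U : Type) (a : nat -> U -> bool).

Fixpoint word m (x : U) : seq bool :=
  if m is n.+1 then a n x :: word n x else [::].

Lemma size_word m x : size (word m x) = m.
Proof. by elim: m => //= m ->. Qed.

(** The latest bit stands first in a word, hence the reversed index. *)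
Lemma nth_word m n x : (m < n)%N -> nth false (word n x) (n.-1 - m) = a m x.
Proof.
elim: n => // n IH; rewrite ltnS leq_eqVlt => /predU1P[->|mn].
  by rewrite subnn.
by case: n mn IH => // n mn /(_ mn) <-; rewrite /= subSn.
Qed.

End word.

Lemma finite_size (Q : set (seq bool)) m : finite_set [set r | size r = m /\ Q r].
Proof.
apply: (@sub_finite_set _ _ (range (fun t : m.-tuple bool => tval t))).
  by move=> r [/eqP rm _]; exists (Tuple rm).
exact: finite_image.
Qed.

Section bits.
Context d (T : measurableType d) (R : realType) (P : probability T R).
Hypothesis P_atomless : atomless P.
Context d' (S : measurableType d') (nu : {measure set S -> \bar R}).
Variables (A : set T) (mA : measurable A) (nuA : nu setT = P A).
Variable b : nat -> S -> bool.
Hypothesis mb : forall m, measurable [set x | b m x].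

(** The hypotheses stand under the existential quantifier, which makes [pick] total and [tree] a
    plain fixpoint. *)
Let pick_spec (C : set T) (c : R) : exists B, measurable C -> 0 <= c <= pr P C ->
  [/\ measurable B, B `<=` C & pr P B = c].
Proof.
have [mC|] := pselect (measurable C); last by exists set0.
have [c0|] := boolP (0 <= c <= pr P C); last by exists set0.
by have [B BP] := atomless_subset P_atomless mC c0; exists B.
Qed.

Let pick C c := projT1 (cid (pick_spec C c)).

Let cell (r : seq bool) := [set x | word b (size r) x = r].

Let cellS c r : cell (c :: r) = cell r `&` [set x | b (size r) x = c].
Proof.
rewrite /cell; apply/seteqP; split => x /=; first by case=> bc wr; split.
by case=> wr bc; rewrite wr bc.
Qed.

Let measurable_cell r : measurable (cell r).
Proof.
elim: r => [|c r IH]; first by rewrite (_ : cell _ = setT)//; apply/seteqP.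
rewrite cellS; apply: measurableI => //; case: c; first exact: mb.
rewrite (_ : [set _ | _] = ~` [set x | b (size r) x]); first exact: measurableC.
by apply/seteqP; split => x /=; case: (b _ x).
Qed.

(* Words are read backwards: [c :: r] refines the cell of [r] by its bit of index [size r]. *)
Fixpoint tree (r : seq bool) : set T :=
  if r is c :: r' then
    let C := pick (tree r') (fine (nu (cell (true :: r')))) in
    if c then C else tree r' `\` C
  else A.

Let nu_fin B : measurable B -> (nu B < +oo)%E.
Proof.
move=> mB; apply: (@le_lt_trans _ _ (nu setT)).
  by apply: le_measure; rewrite ?inE.
by rewrite nuA prE// ltry.
Qed.

Let nuE B : measurable B -> nu B = (fine (nu B))%:E.
Proof. by move=> mB; rewrite fineK// ge0_fin_numE ?nu_fin. Qed.

(** The equality of masses is what lets the induction continue: a subcell has at most the mass of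
    [cell r], hence an event of its mass fits into [tree r]. *)
Let treeP r : [/\ measurable (tree r), P (tree r) = nu (cell r) &
  tree (true :: r) `<=` tree r].
Proof.
have aux r' : measurable (tree r') -> P (tree r') = nu (cell r') ->
    let C := pick (tree r') (fine (nu (cell (true :: r')))) in
    [/\ measurable C, C `<=` tree r' & pr P C = fine (nu (cell (true :: r')))].
  move=> mr Pr; rewrite /pick; case: cid => B /= /(_ mr); apply.
  rewrite fine_ge0//= /pr Pr -lee_fin -!nuE//; apply: le_measure; rewrite ?inE//.
  by rewrite cellS; exact: subIsetl.
suff [mr Pr] : measurable (tree r) /\ P (tree r) = nu (cell r).
  by split => //; have [] := aux _ mr Pr.
elim: r => [|c r [mr Pr]].
  by split => //=; rewrite -nuA; congr (nu _); apply/seteqP.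
have [mC CA PC] := aux _ mr Pr.
have Ct : P (tree (true :: r)) = nu (cell (true :: r)).
  by rewrite prE// PC -nuE.
case: c => //; split; first exact: measurableD.
rewrite [LHS]prE; last exact: measurableD.
rewrite prD// PC /pr Pr EFinB -!nuE//.
rewrite !cellS -measureD//; last by rewrite nu_fin.
  congr (nu _); apply/seteqP; split => x /= [Cx].
    by move=> nb; split => //; case: (b _ x) nb => // /(_ erefl).
  by move=> ->.
exact: mb.
Qed.

Let alpha m w := `[< exists r, size r = m /\ tree (true :: r) w >].

Let sub_tree r : tree r `<=` A.
Proof.
elim: r => // c r IH; have [_ _ s] := treeP r; apply: subset_trans IH.
by case: c => //; exact: subDsetl.
Qed.

(** The events [tree r] are the cells of the new bits [alpha] on [A]; in particular those of one
    length are disjoint. *)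
Let tree_word r w : A w -> tree r w <-> word alpha (size r) w = r.
Proof.
move=> Aw; move: {2}(size r) (erefl (size r)) => n.
elim: n r => [[]//|n IH [//|c r] [rn]].
have alE : tree r w -> alpha (size r) w <-> tree (true :: r) w.
  move=> trw; split=> [/asboolP[r' [sr' tr']]|tr]; last by apply/asboolP; exists r.
  suff -> : r = r' by [].
  have /IH <- // : tree r w by [].
  rewrite -sr'; apply/IH; first by rewrite sr'.
  by have [_ _] := treeP r'; exact.
rewrite [word _ _ _]/=; split.
  move=> trc; have trw : tree r w.
    by case: c trc => [|[]//]; have [_ _] := treeP r; exact.
  have -> : word alpha (size r) w = r by apply/IH.
  congr (_ :: _); case: c trc => [/alE -> //|[_ ntr]].
  by apply/negP => /(alE trw).
case=> cE /(IH _ rn) trw; case: c cE => cE; first by apply/(alE trw); rewrite cE.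
by split => // /(alE trw); rewrite cE.
Qed.

(** A condition on the first [M] bits is a finite disjoint union of cells of length [M], and
    corresponding cells have equal mass. Conditions on real values depend on infinitely many bits
    and are reached by approximation afterwards. *)
Lemma transfer_bits : exists a : nat -> T -> bool,
  (forall m, measurable [set w | a m w]) /\
  forall M (Q : set (nat -> bool)),
    (forall s t, (forall m, (m < M)%N -> s m = t m) -> Q s -> Q t) ->
    P (A `&` [set w | Q (a^~ w)]) = nu [set x | Q (b^~ x)].
Proof.
exists alpha; split=> [m|M Q QM].
  rewrite (_ : [set _ | _] = \bigcup_(r in [set r | size r = m /\ True]) tree (true :: r)).
    apply: fin_bigcup_measurable; first exact: finite_size.
    by move=> r _; have [] := treeP (true :: r).
  apply/seteqP; split => w /=; first by move=> /asboolP[r [rm tr]]; exists r.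
  by move=> [r [rm _] tr]; apply/asboolP; exists r.
pose D := [set r : seq bool | size r = M /\ Q (fun m => nth false r (M.-1 - m))].
have QE U (a : nat -> U -> bool) (x : U) : Q (a^~ x) <-> D (word a M x).
  rewrite /D /= size_word; split=> [Qa|[_]].
    by split => //; apply: QM Qa => m mM; rewrite nth_word.
  by apply: QM => m mM; rewrite nth_word.
have -> : A `&` [set w | Q (alpha^~ w)] = \bigcup_(r in D) tree r.
  apply/seteqP; split => [w [Aw /QE Dw]|w [r Dr tr]].
    by exists (word alpha M w) => //; apply/tree_word; rewrite // size_word.
  split; first exact: sub_tree tr.
  apply/QE; move: tr => /[dup] /sub_tree Aw /(tree_word r Aw).
  by case: (Dr) => -> _ ->.
have -> : [set x | Q (b^~ x)] = \bigcup_(r in D) cell r.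
  apply/seteqP; split => [w /= /QE Dw|w [r Dr cr]].
    by exists (word b M w) => //; rewrite /cell /= size_word.
  by apply/QE; move: cr; rewrite /cell /=; case: (Dr) => -> _ ->.
rewrite !measure_fin_bigcup//; try exact: finite_size.
- by apply: eq_fsbigr => r _; have [] := treeP r.
- move=> r s [rM _] [sM _] [x [/=]].
  by rewrite /cell /= rM sM => -> .
- move=> r s [rM _] [sM _] [x [rx sx]]; have Ax := sub_tree rx.
  by move: rx sx; rewrite !(tree_word _ Ax) rM sM => ->.
- by move=> r _; have [] := treeP r.
Qed.

End bits.

Lemma measurable_fun_natr_bool d (T : measurableType d) (R : realType) (f : T -> bool) :
  measurable [set x | f x] -> measurable_fun setT (fun x => (f x)%:R : R).
Proof.
move=> mf; rewrite (_ : (fun x => _) = \1_[set x | f x]); first exact: measurable_indic.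
apply/funext => x; rewrite indicE (_ : (x \in _) = f x)//.
by apply/idP/idP; rewrite inE.
Qed.

(** Right continuity of the distribution function, as an inequality that serves both limits of laws
    and quantiles. *)
Lemma le_measure_right d (T : measurableType d) (R : realType)
    (m : {measure set T -> \bar R}) (f : T -> R) (a : \bar R) (x : R) :
  (m setT < +oo)%E -> measurable_fun setT f ->
  (forall k : nat, (a <= m (f @^-1` `]-oo, (x + k.+1%:R^-1)%R]))%E) ->
  (a <= m (f @^-1` `]-oo, x]))%E.
Proof.
move=> my mf.
have mpre y : measurable (f @^-1` `]-oo, y]).
  by rewrite -[X in measurable X]setTI; exact: (mf measurableT).
pose F k := f @^-1` `]-oo, x + k.+1%:R^-1] => Fk.
have FI : f @^-1` `]-oo, x] = \bigcap_k F k.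
  apply/seteqP; split => w; rewrite /F /= in_itv/=.
    by move=> fx k _ /=; rewrite in_itv/= (le_trans fx)// lerDl invr_ge0.
  move=> Fw; apply/ler_addgt0Pr => eps eps0.
  have [k ke] : exists k : nat, k.+1%:R^-1 <= eps.
    exists (Num.bound eps^-1); rewrite invf_ple ?posrE//.
    rewrite (le_trans (ltW (archi_boundP _)))// ?invr_ge0 ?ltW//.
    by rewrite ltr_nat.
  by have := Fw k I; rewrite /= in_itv/= => /le_trans; apply; rewrite lerD2l.
rewrite FI.
have cvgF : (m \o F) k @[k --> \oo] --> m (\bigcap_k F k).
  apply: nonincreasing_cvg_mu.
  - by apply: le_lt_trans my; apply: le_measure; rewrite ?inE//; exact: mpre.
  - by move=> k; exact: mpre.
  - by apply: bigcapT_measurable => k; exact: mpre.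
  - apply/nonincreasing_seqP => k; apply/subsetPset => w; rewrite /F /= !in_itv/=.
    by move=> /le_trans; apply; rewrite lerD2l lef_pV2 ?posrE// ler_nat.
rewrite -(cvg_lim _ cvgF)//; apply: lime_ge; first by apply/cvg_ex; eexists; exact: cvgF.
exact: nearW.
Qed.


Section law_limit.
Context d1 d2 (T1 : measurableType d1) (T2 : measurableType d2) (R : realType).
Variables (m1 : {measure set T1 -> \bar R}) (m2 : {measure set T2 -> \bar R}).
Hypothesis m2y : (m2 setT < +oo)%E.
Variables (f1 : T1 -> R) (f2 : T2 -> R) (g1 : nat -> T1 -> R) (g2 : nat -> T2 -> R).
Hypotheses (mf1 : measurable_fun setT f1) (mf2 : measurable_fun setT f2).
Hypotheses (mg1 : forall n, measurable_fun setT (g1 n))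
           (mg2 : forall n, measurable_fun setT (g2 n)).
Variable e : nat -> R.
Hypothesis e0 : forall eps : R, 0 < eps -> exists n, e n <= eps.
Hypothesis fg1 : forall n w, `|f1 w - g1 n w| <= e n.
Hypothesis fg2 : forall n w, `|f2 w - g2 n w| <= e n.
Hypothesis g12 : forall n x, m1 (g1 n @^-1` `]-oo, x]) = m2 (g2 n @^-1` `]-oo, x]).

Let mpre d (U : measurableType d) (f : U -> R) x :
  measurable_fun setT f -> measurable (f @^-1` `]-oo, x]).
Proof. by move=> mf; rewrite -[X in measurable X]setTI; exact: (mf measurableT). Qed.

(** Uniform closeness costs a shift of the threshold by [2 * e n], which right continuity removes.
    Exchanging the two spaces yields the reverse inequality. *)
Lemma law_limit_le x : (m1 (f1 @^-1` `]-oo, x]) <= m2 (f2 @^-1` `]-oo, x]))%E.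
Proof.
pose F k := f2 @^-1` `]-oo, x + k.+1%:R^-1].
have Fk k : (m1 (f1 @^-1` `]-oo, x]) <= m2 (F k))%E.
  have [|n en] := e0 (_ : 0 < k.+1%:R^-1 / 2); first by rewrite divr_gt0// invr_gt0.
  apply: (@le_trans _ _ (m1 (g1 n @^-1` `]-oo, x + e n]))).
    apply: le_measure; rewrite ?inE; [exact: mpre|exact: mpre|].
    move=> w /=; rewrite !in_itv/=; have := fg1 n w.
    by rewrite ler_norml => /andP[? ?] ?; lra.
  rewrite g12; apply: le_measure; rewrite ?inE; [exact: mpre|exact: mpre|].
  move=> w; rewrite /F /= !in_itv/=; have := fg2 n w.
  rewrite ler_norml => /andP[? ?] ?.
  by move: en; move: (k.+1%:R^-1) => t ?; lra.
exact: le_measure_right.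
Qed.

End law_limit.

(** * Binary expansions of reals in the unit interval *)

Section binary.
Context (R : realType).
Implicit Types (s : nat -> bool) (x : R).

Definition bsum s (K : nat) : R := \sum_(i < K) (s i)%:R / 2 ^+ i.+1.

Definition bin s : R := limn (bsum s).

Lemma bsumS s K : bsum s K.+1 = bsum s K + (s K)%:R / 2 ^+ K.+1.
Proof. by rewrite /bsum big_ord_recr. Qed.

Lemma nondecreasing_bsum s : nondecreasing_seq (bsum s).
Proof.
by apply/nondecreasing_seqP => n; rewrite bsumS lerDl divr_ge0// exprn_ge0.
Qed.

(** The upper bounds [bsum s n + 2 ^- n] do not increase: a further digit adds at most what the
    error term loses. *)
Lemma bsum_le s K n : bsum s n <= bsum s K + 2 ^- K.
Proof.
have [Kn|/ltnW nK] := leqP K n; last first.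
  by rewrite (le_trans (nondecreasing_bsum _ nK))// lerDl invr_ge0 exprn_ge0.
suff : bsum s n + 2 ^- n <= bsum s K + 2 ^- K.
  by apply: le_trans; rewrite lerDl invr_ge0 exprn_ge0.
have : nonincreasing_seq (fun n => bsum s n + 2 ^- n); last exact.
apply/nonincreasing_seqP => m; rewrite bsumS -addrA lerD2l exprS invfM.
have : 0 <= (2 ^+ m)^-1 :> R by rewrite invr_ge0 exprn_ge0.
by case: (s m); rewrite /=; lra.
Qed.

Lemma cvg_bsum s : cvgn (bsum s).
Proof.
apply: nondecreasing_is_cvgn; first exact: nondecreasing_bsum.
by exists (bsum s 0 + 2 ^- 0) => _ [n _ <-]; exact: bsum_le.
Qed.

Lemma bin_bsum s K : bsum s K <= bin s <= bsum s K + 2 ^- K.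
Proof.
apply/andP; split.
  by apply: nondecreasing_cvgn_le; [exact: nondecreasing_bsum|exact: cvg_bsum].
by apply: limr_le; [exact: cvg_bsum|apply: nearW => n; exact: bsum_le].
Qed.

Lemma bin_ge0_le1 s : 0 <= bin s <= 1.
Proof. by have := bin_bsum s 0; rewrite /bsum big_ord0 expr0 invr1 add0r. Qed.

(** The doubling map, with the convention at the jump that makes 1 a fixed point with all digits 1;
    the closed interval is then stable. *)
Fixpoint brem k x : R :=
  if k is n.+1 then 2 * brem n x - (1 <= 2 * brem n x)%R%:R else x.

Definition digit x k := 1 <= 2 * brem k x.

Lemma brem_itv k x : 0 <= x <= 1 -> 0 <= brem k x <= 1.
Proof.
move=> x01; elim: k => //= k /andP[r0 r1].
by case: (lerP 1 (2 * brem k x)) => h; apply/andP; split; rewrite /=; lra.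
Qed.

Lemma bsum_digit k x : x = bsum (digit x) k + brem k x / 2 ^+ k.
Proof.
elim: k => [|k IH]; first by rewrite /bsum big_ord0 add0r expr0 divr1.
rewrite [LHS]IH bsumS -addrA; congr (_ + _); rewrite /= /digit exprS.
by field; rewrite expf_neq0.
Qed.

Lemma digit_bsum k x : 0 <= x <= 1 -> bsum (digit x) k <= x <= bsum (digit x) k + 2 ^- k.
Proof.
move=> /(brem_itv k)/andP[r0 r1].
have k0 : 0 <= (2 ^+ k)^-1 :> R by rewrite invr_ge0 exprn_ge0.
rewrite {2 3}(bsum_digit k x) lerDl mulr_ge0//= lerD2l.
by rewrite -[leRHS]mul1r ler_wpM2r.
Qed.

End binary.

(** * Copying a sequence of bounded functions onto an event *)

Section transfer.
Context d (T : measurableType d) (R : realType) (P : probability T R).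
Hypothesis P_atomless : atomless P.
Context d' (S : measurableType d') (nu : {measure set S -> \bar R}).
Variables (A : set T) (mA : measurable A) (nuA : nu setT = P A).
Variable F : nat -> S -> R.
Hypothesis mF : forall j, measurable_fun setT (F j).
Hypothesis F01 : forall j x, 0 <= F j x <= 1.

Let b m x := if unpickle m is Some (j, k) then digit (F j x) k else false.

Let measurable_brem j k : measurable_fun setT (fun x => brem k (F j x)).
Proof.
elim: k => //= k IH.
have m2 : measurable_fun setT (fun x => 2 * brem k (F j x)).
  by apply: measurable_funM.
apply: measurable_funB => //.
apply: measurable_fun_natr_bool.
rewrite (_ : [set _ | _] = (fun x => 2 * brem k (F j x)) @^-1` `[1, +oo[).
  by rewrite -[X in measurable X]setTI; exact: m2.
by apply/seteqP; split => x /=; rewrite in_itv/= andbT.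
Qed.


Let measurable_b m : measurable [set x | b m x].
Proof.
rewrite /b; case: (unpickle m) => [[j k]|]; last first.
  by rewrite (_ : [set _ | _] = set0); [exact: measurable0|apply/seteqP; split].
rewrite (_ : [set _ | _] = (fun x => 2 * brem k (F j x)) @^-1` `[1, +oo[).
  rewrite -[X in measurable X]setTI; apply: measurable_funM => //.
by apply/seteqP; split => x /=; rewrite in_itv/= andbT.
Qed.

(** The digits of all the [F j] are merged into one bit sequence through [pickle], so that joint
    laws are carried along. Linear combinations of two terms are enough for the marginals and the
    increments of a chain. *)
Lemma transfer : exists Z : nat -> T -> R,
  [/\ forall j, measurable_fun setT (Z j), forall j w, 0 <= Z j w <= 1 &
    forall i j a c x, P (A `&` [set w | a * Z i w + c * Z j w <= x]) =
                      nu [set y | a * F i y + c * F j y <= x]].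
Proof.
have [al [mal alP]] := transfer_bits P_atomless mA nuA measurable_b.
pose s (j : nat) w : nat -> bool := fun k => al (pickle (j, k)) w.
have ms K j : measurable_fun setT (fun w => bsum R (s j w) K).
  apply: measurable_sum => k; apply: measurable_funM => //.
  apply: measurable_fun_natr_bool; exact: mal.
have mZ j : measurable_fun setT (fun w => bin R (s j w)).
  apply: (@measurable_fun_cvg _ _ _ _ (fun K w => bsum R (s j w) K)) => //.
  by move=> w _; exact: cvg_bsum.
exists (fun j w => bin R (s j w)); split => // [j w|i j a c x].
  exact: bin_ge0_le1.
have bE (j0 : nat) y (k : nat) : b (pickle (j0, k)) y = digit (F j0 y) k by rewrite /b
  pickleK.
pose f1 w := a * bin R (s i w) + c * bin R (s j w).
pose f2 y := a * F i y + c * F j y.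
pose g1 K w := a * bsum R (s i w) K + c * bsum R (s j w) K.
pose g2 K y := a * bsum R (digit (F i y)) K + c * bsum R (digit (F j y)) K.
pose e K : R := (`|a| + `|c|) / 2 ^+ K.
have mlin d0 (U : measurableType d0) (h1 h2 : U -> R) : measurable_fun setT h1 ->
    measurable_fun setT h2 -> measurable_fun setT (fun u => a * h1 u + c * h2 u).
  by move=> mh1 mh2; apply: measurable_funD; apply: measurable_funM.
have e0 eps : 0 < eps -> exists n, e n <= eps.
  move=> eps0; have [n ne] : exists n : nat, (`|a| + `|c|) / eps < n%:R.
    exists (Num.bound ((`|a| + `|c|) / eps)); apply: archi_boundP.
    by rewrite divr_ge0 ?addr_ge0// ltW.
  exists n; rewrite /e ler_pdivrMr ?exprn_gt0// mulrC -ler_pdivrMr//.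
  rewrite (le_trans (ltW ne))// -natrX ler_nat ltnW// ltn_expl//.
have err (x1 x2 y1 y2 : R) K : y1 <= x1 <= y1 + 2 ^- K -> y2 <= x2 <= y2 + 2 ^- K ->
    `|a * x1 + c * x2 - (a * y1 + c * y2)| <= e K.
  move=> /andP[h1 h2] /andP[h3 h4]; rewrite opprD addrACA -!mulrBr /e mulrDl.
  by rewrite (le_trans (ler_normD _ _))// !normrM lerD// ler_wpM2l// ger0_norm//; lra.
have bsum_b k y K : bsum R (digit (F k y)) K = bsum R (fun l => b (pickle (k, l)) y) K.
  by apply: eq_bigr => l _; rewrite bE.
have g12 K z : mrestr P mA (g1 K @^-1` `]-oo, z]) = nu (g2 K @^-1` `]-oo, z]).
  (* This condition reads the first [K] digits of two coordinates, hence only bits whose index is at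
     most the maximum of finitely many codes. *)
  pose Q (t : nat -> bool) := a * bsum R (fun l => t (pickle (i, l))) K +
                              c * bsum R (fun l => t (pickle (j, l))) K <= z.
  have /(_ (\max_(k < K) maxn (pickle (i, nat_of_ord k)) (pickle (j, nat_of_ord k))).+1
    Q) := alP.
  rewrite /mrestr setIC => h; rewrite [LHS]h.
    by congr (nu _); apply/seteqP; split => y; rewrite /g2 /Q /= in_itv/= !bsum_b.
  move=> t u tu; rewrite /Q.
  have lt_max (k : 'I_K) : (maxn (pickle (i, nat_of_ord k)) (pickle (j, nat_of_ord k)) <
      (\max_(k < K) maxn (pickle (i, nat_of_ord k)) (pickle (j, nat_of_ord k))).+1)%N.
    by rewrite ltnS; exact: (@leq_bigmax _ (fun k : 'I_K => maxn (pickle (i, nat_of_ord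
      k)) (pickle (j, nat_of_ord k)))).
  rewrite (_ : bsum R (fun l => t (pickle (i, l))) K = bsum R (fun l => u (pickle (i,
    l))) K); last first.
    by apply: eq_bigr => k _; rewrite tu// (leq_ltn_trans _ (lt_max k))// leq_maxl.
  rewrite (_ : bsum R (fun l => t (pickle (j, l))) K = bsum R (fun l => u (pickle (j,
    l))) K)//.
  by apply: eq_bigr => k _; rewrite tu// (leq_ltn_trans _ (lt_max k))// leq_maxr.
have mg2 K : measurable_fun setT (g2 K).
  apply: mlin; apply: measurable_sum => k; apply: measurable_funM => //.
    by apply: measurable_fun_natr_bool;
      have := measurable_b (pickle (i, nat_of_ord k)); rewrite /b pickleK.
  by apply: measurable_fun_natr_bool; have := measurable_b (pickle (j, nat_of_ord k));
    rewrite /b pickleK.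
have fin1 : (mrestr P mA setT < +oo)%E.
  by rewrite /mrestr setTI prE// ltry.
have fin2 : (nu setT < +oo)%E by rewrite nuA prE// ltry.
have fg1 K w : `|f1 w - g1 K w| <= e K by apply: err; exact: bin_bsum.
have fg2 K y : `|f2 y - g2 K y| <= e K by apply: err; exact: digit_bsum.
have := @law_limit_le _ _ _ _ _ (mrestr P mA) nu fin2 f1 f2 g1 g2 (mlin _ _ _ _ (mZ i) (mZ j))
  (mlin _ _ _ _ (mF i) (mF j)) (fun K => mlin _ _ _ _ (ms K i) (ms K j)) mg2 e e0 fg1
    fg2 g12 x.
have := @law_limit_le _ _ _ _ _ nu (mrestr P mA) fin1 f2 f1 g2 g1
  (mlin _ _ _ _ (mF i) (mF j)) (mlin _ _ _ _ (mZ i) (mZ j)) mg2 (fun K => mlin _ _ _ _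
    (ms K i) (ms K j))
   e e0 fg2 fg1 (fun K z => esym (g12 K z)) x.
move=> h1 h2; have /le_anti := introT andP (conj h2 h1).
rewrite /mrestr setIC => h.
rewrite (_ : [set y | _] = f2 @^-1` `]-oo, x]); last first.
  by apply/seteqP; split => y; rewrite /= in_itv.
by rewrite -h; congr (P (_ `&` _)).
Qed.

End transfer.

(** * Bounded coboundaries *)

Lemma lebesgue_measure_shift (R : realType) (a : R) (C : set R) :
  measurable C ->
  lebesgue_measure ((fun z => z + a) @^-1` C) = lebesgue_measure C.
Proof.
move=> mC.
have mf : measurable_fun setT ((fun z => z + a) : measurableTypeR R -> measurableTypeR R).
  exact: measurable_funD.
pose f : {mfun measurableTypeR R >-> measurableTypeR R} :=
  HB.pack ((fun z => z + a) : measurableTypeR R -> measurableTypeR R)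
    (isMeasurableFun.Build _ _ (measurableTypeR R) (measurableTypeR R) _ mf).
apply/esym; rewrite (@lebesgue_measure_unique _ (pushforward lebesgue_measure f))//.
move=> _ [[x y] _ <-] /=; rewrite /pushforward.
rewrite (_ : _ @^-1` _ = `]x - a, y - a]%classic); last first.
  by apply/seteqP; split => z /=; rewrite !in_itv/= ltrBlDr lerBrDr.
rewrite !lebesgue_measure_itv/= !lte_fin ltrD2r; case: ifP => // _.
by rewrite -!EFinB; congr (_%:E); ring.
Qed.

(** The map exchanges the blocks [[0, b[] and [[b, a + b[]: it is the rotation by [a] of a circle of
    length [a + b], a translation on each block. *)
Lemma lebesgue_measure_exchange (R : realType) (a b : R) (C : set R) :
  0 <= a -> 0 <= b -> measurable C ->
  lebesgue_measure [set z | 0 <= z < a + b /\ C (if z < b then z + a else z - b)] =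
  lebesgue_measure (C `&` `[0, a + b[%classic).
Proof.
move=> a0 b0 mC.
have -> : [set z | 0 <= z < a + b /\ C (if z < b then z + a else z - b)] =
    ((fun z => z + a) @^-1` (C `&` `[a, a + b[%classic)) `|`
    ((fun z => z + - b) @^-1` (C `&` `[0, a[%classic)).
  apply/seteqP; split => z /=; rewrite !in_itv/=.
    by move=> [/andP[z0 zab]]; case: ltP => zb Cz; [left|right]; split => //;
      apply/andP; split; lra.
  move=> [] [Cz /andP[h1 h2]].
    have zb : z < b by lra.
    by rewrite zb; split => //; apply/andP; split; lra.
  have -> : (z < b) = false by apply/negbTE; rewrite -leNgt; lra.
  by split => //; apply/andP; split; lra.
have lebU (X Y : set R) : measurable X -> measurable Y -> X `&` Y = set0 ->
    lebesgue_measure (X `|` Y) = (lebesgue_measure X + lebesgue_measure Y)%E.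
  exact: (@measureU _ _ _ (@lebesgue_measure R)).
have mi1 : measurable (C `&` `[a, a + b[%classic) by apply: measurableI.
have mi2 : measurable (C `&` `[0, a[%classic) by apply: measurableI.
have msh c D : measurable D -> measurable ((fun z : R => z + c) @^-1` D).
  move=> mD; rewrite -[X in measurable X]setTI.
  have mf : measurable_fun setT (fun z : R => z + c) by exact: measurable_funD.
  exact: mf.
rewrite lebU; [|exact: msh|exact: msh|]; last first.
  apply/seteqP; split => z //=; rewrite !in_itv/= => -[[_ /andP[? ?]] [_ /andP[? ?]]].
  by exfalso; lra.
rewrite !lebesgue_measure_shift// -lebU//.
  congr (lebesgue_measure _); rewrite -setIUr; congr (_ `&` _).
  apply/seteqP; split => z /=; rewrite !in_itv/=.
    by move=> [] /andP[? ?]; apply/andP; split; lra.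
  by move=> /andP[? ?]; have [az|za] := leP a z; [left|right]; apply/andP; split; lra.
apply/seteqP; split => z //=; rewrite !in_itv/= => -[[_ /andP[? ?]] [_ /andP[? ?]]].
by exfalso; lra.
Qed.

(** The jump [a] occurs on an interval of length [b], the jump [- b] on one of length [a]. *)
Lemma lebesgue_measure_exchange_jump (R : realType) (a b : R) (B : set R) :
  0 <= a -> 0 <= b ->
  lebesgue_measure [set z | 0 <= z < a + b /\ B (if z < b then a else - b)] =
  (\1_B a * b + a * \1_B (- b))%:E.
Proof.
move=> a0 b0.
have L (I J : R) : I <= J -> lebesgue_measure `[I, J[%classic = (J - I)%:E.
  rewrite le_eqVlt => /predU1P[->|IJ]; rewrite lebesgue_measure_itv/= lte_fin.
    by rewrite ltxx subrr.
  by rewrite IJ EFinB.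
have lebU (X Y : set R) : measurable X -> measurable Y -> X `&` Y = set0 ->
    lebesgue_measure (X `|` Y) = (lebesgue_measure X + lebesgue_measure Y)%E.
  exact: (@measureU _ _ _ (@lebesgue_measure R)).
pose I1 := if a \in B then `[0, b[%classic else set0.
pose I2 := if - b \in B then `[b, a + b[%classic else set0.
have -> : [set z | 0 <= z < a + b /\ B (if z < b then a else - b)] = I1 `|` I2.
  rewrite /I1 /I2; apply/seteqP; split => z /=.
    move=> [/andP[z0 zab]]; case: ltP => zb /mem_set ->; [left|right] => /=;
    by rewrite in_itv/=; apply/andP; split.
  case; case: ifP => //; rewrite inE => h; rewrite /= in_itv/= => /andP[h1 h2].
    by rewrite h2; split => //; apply/andP; split; lra.
  have -> : (z < b) = false by apply/negbTE; rewrite -leNgt; lra.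
  by split => //; apply/andP; split; lra.
rewrite lebU; first last.
- rewrite /I1 /I2; apply/seteqP; split => z //=.
  case: ifP => _; case: ifP => _; rewrite /= ?in_itv/=; move=> [] //.
  by move=> /andP[_ h] /andP[h' _]; lra.
- by rewrite /I2; case: ifP.
- by rewrite /I1; case: ifP.
rewrite /I1 /I2 !indicE EFinD; congr (_ + _)%E; case: ifP => _.
- by rewrite L// mul1r subr0.
- by rewrite mul0r measure0.
- by rewrite L ?lerDr// mulr1 addrK.
- by rewrite mulr0 measure0.
Qed.

Lemma integral_prod_mul d1 d2 (T1 : measurableType d1) (T2 : measurableType d2)
    (R : realType) (m1 : {sigma_finite_measure set T1 -> \bar R})
    (m2 : {sigma_finite_measure set T2 -> \bar R}) (h : T1 -> R) (k : T2 -> R) :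
  measurable_fun setT h -> measurable_fun setT k ->
  (forall x, 0 <= h x) -> (forall x, 0 <= k x) ->
  (\int[m1 \x m2]_w (h w.1 * k w.2)%:E = (\int[m1]_x (h x)%:E) * \int[m2]_y (k y)%:E)%E.
Proof.
move=> mh mk h0 k0; rewrite fubini_tonelli1/=; last 2 first.
- apply/measurable_EFinP; apply: measurable_funM; exact: measurableT_comp.
- by move=> w; rewrite lee_fin mulr_ge0.
rewrite /fubini_F /=.
under eq_integral => x _.
  under eq_integral do rewrite EFinM.
  rewrite ge0_integralZl//; last 3 first.
  - exact/measurable_EFinP.
  - by move=> y _; rewrite lee_fin.
  - by rewrite lee_fin.
  over.
rewrite ge0_integralZr//.
- exact/measurable_EFinP.
- by move=> x _; rewrite lee_fin.
- by apply: integral_ge0 => y _; rewrite lee_fin.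
Qed.

(** * A stationary chain whose increments have a given centred law *)

Section exchange_space.
Context d (T : measurableType d) (R : realType) (P : probability T R).
Variables (A : set T) (mA : measurable A) (D : T -> R).
Hypothesis mD : measurable_fun setT D.
Variable M : R.
Hypothesis M0 : 0 < M.
Hypothesis DM : forall x, `|D x| <= M.
Hypothesis P_atomless : atomless P.

Let S := (T * T * measurableTypeR R)%type.
Let Ap := A `&` [set x | 0 < D x].
Let An := A `&` [set x | D x <= 0].
Let u x : R := \1_Ap x * D x.
Let v x : R := \1_An x * - D x.

Variable c : R.
Hypothesis c0 : 0 < c.
Hypothesis uE : (\int[P]_x (u x)%:E = c%:E)%E.
Hypothesis vE : (\int[P]_x (v x)%:E = c%:E)%E.

Let mAp : measurable Ap.
Proof. by apply: measurableI => //; exact: measurable_set_gt. Qed.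

Let mAn : measurable An.
Proof. by apply: measurableI => //; exact: measurable_set_le. Qed.

Let u0 x : 0 <= u x.
Proof.
rewrite /u indicE; case: (boolP (x \in Ap)) => [|_]; last by rewrite mul0r.
by rewrite inE => -[_ /= /ltW]; rewrite mul1r.
Qed.

Let v0 x : 0 <= v x.
Proof.
rewrite /v indicE; case: (boolP (x \in An)) => [|_]; last by rewrite mul0r.
by rewrite inE => -[_ /=]; rewrite mul1r oppr_ge0.
Qed.

Let mu_ : measurable_fun setT u.
Proof. by apply: measurable_funM => //; exact: measurable_indic. Qed.

Let mv : measurable_fun setT v.
Proof.
by apply: measurable_funM; [exact: measurable_indic|exact: measurable_funN].
Qed.

(* A point is [((w1, w2), z)]: the values [u w1 > 0] and [- v w2 <= 0] of [D] are drawn with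
   weight [u w1 + v w2], the length of the range of [z]; this size bias makes the jump
   [(tau x).2 - x.2], equal to one of the two values, distributed as [D] on [A]. *)
Let W : set S := [set x | [/\ Ap x.1.1, An x.1.2 & 0 <= x.2 < u x.1.1 + v x.1.2]].

Let m11 : measurable_fun setT (fun x : S => x.1.1).
Proof. exact: (measurableT_comp measurable_fst measurable_fst). Qed.

Let m12 : measurable_fun setT (fun x : S => x.1.2).
Proof. exact: (measurableT_comp measurable_snd measurable_fst). Qed.

Let m2 : measurable_fun setT (fun x : S => x.2 : R).
Proof. exact: measurable_snd. Qed.

Let mu1 : measurable_fun setT (fun x : S => u x.1.1).
Proof. exact: measurableT_comp. Qed.

Let mv2 : measurable_fun setT (fun x : S => v x.1.2).
Proof. exact: measurableT_comp. Qed.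

Let mlt (f g : S -> R) : measurable_fun setT f -> measurable_fun setT g ->
  measurable [set x | f x < g x].
Proof.
move=> mf mg; have := measurable_fun_ltr mf mg.
by move=> /(_ measurableT [set true] I); rewrite setTI.
Qed.

Let mW : measurable W.
Proof.
rewrite (_ : W = (fun x : S => x.1.1) @^-1` Ap `&` ((fun x : S => x.1.2) @^-1` An `&`
    (~` [set x : S | (x.2 : R) < 0] `&` [set x : S | (x.2 : R) < u x.1.1 + v x.1.2]))).
  apply: measurableI; first by rewrite -[X in measurable X]setTI; exact: m11.
  apply: measurableI; first by rewrite -[X in measurable X]setTI; exact: m12.
  apply: measurableI; first by apply: measurableC; apply: mlt.
  by apply: mlt => //; exact: measurable_funD.
apply/seteqP; split => x; rewrite /W /=.
  by move=> [? ? /andP[x0 x1]]; split => //; split => //; split => //; apply/negP;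
    rewrite -leNgt.
by move=> [? [? [/negP]]]; rewrite -leNgt => -> -> ; split.
Qed.

Let tau (x : S) : S := (x.1, if x.2 < v x.1.2 then x.2 + u x.1.1 else x.2 - v x.1.2).

Let mtau : measurable_fun setT tau.
Proof.
apply/measurable_fun_pairP; split; first exact: measurable_fst.
apply: measurable_fun_ifT.
- exact: measurable_fun_ltr.
- exact: measurable_funD.
- exact: measurable_funB.
Qed.

Let tauW x : W x -> W (tau x).
Proof.
rewrite /W /tau /=; move: x => [[x y] z] /= [Ax Ay /andP[z0 z1]]; split => //.
by case: ltP => zv; apply/andP; split; have := u0 x; have := v0 y; lra.
Qed.

Let nu0 := ((P \x P) \x (@lebesgue_measure R))%E.
Let ic : {nonneg R} := NngNum (ltW (divr_gt0 ltr01 c0)).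
(** Before normalisation the region [W] has mass [c * P A]: the size bias contributes [u] and [v],
    and both integrate to [c]. *)
Let nu : {measure set S -> \bar R} := mscale ic (mrestr nu0 mW).

Let nuE B : measurable B ->
  nu B = ((c^-1)%:E * \int[P \x P]_w (lebesgue_measure (xsection (B `&` W) w)))%E.
Proof.
by move=> mB; rewrite /nu /= /mscale /= mul1r /mrestr.
Qed.

Let xsP (B : set S) w z : xsection B w z <-> B (w, z).
Proof. by rewrite /xsection /= inE. Qed.

Let inW B w : xsection (B `&` W) w =
  if (w.1 \in Ap) && (w.2 \in An) then
    xsection B w `&` `[0, u w.1 + v w.2[%classic else set0.
Proof.
case: ifPn => [/andP[/set_mem Aw /set_mem Aw']|nA].
  apply/seteqP; split => z.
    by move=> /xsP[Bz [_ _ h]]; split; [exact/xsP|rewrite /= in_itv].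
  by move=> [/xsP Bz]; rewrite /= in_itv/= => h; apply/xsP; split.
apply/seteqP; split => z // /xsP[_ [/mem_set h1 /mem_set h2 _]].
by move: nA; rewrite h1 h2.
Qed.

Let mxs (B : set S) w : measurable B -> measurable (xsection B w : set R).
Proof. exact: measurable_xsection. Qed.

Let nu_tau B : measurable B -> nu (tau @^-1` B) = nu B.
Proof.
move=> mB.
have mtB : measurable (tau @^-1` B).
  by rewrite -[X in measurable X]setTI; exact: mtau.
rewrite (nuE mtB) (nuE mB); congr (_ * _)%E; apply: eq_integral => w _; rewrite !inW.
case: ifP => // _; rewrite -[RHS]lebesgue_measure_exchange//; last exact: mxs.
congr (lebesgue_measure _); apply/seteqP; split => z.
  by move=> [/xsP Bz]; rewrite /= in_itv/= => h; split => //; exact/xsP.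
by move=> [h /xsP Bz]; split; [exact/xsP|rewrite /= in_itv].
Qed.

(** Over a pair of points the jump is [u] of the first on a length [v] of the second, and
    conversely. Integrating the length over the partner gives the factor [c] in both cases, which
    the normalisation cancels. The value 0 counts as nonpositive, so that [Ap] and [An] exhaust
    [A]. *)
Let nu_jump (B : set R) : measurable B ->
  nu [set x : S | B ((tau x).2 - x.2)] = P (A `&` D @^-1` B).
Proof.
move=> mB.
have mj : measurable_fun setT (fun x : S => (tau x).2 - x.2 : R).
  by apply: measurable_funB => //; exact: (measurableT_comp measurable_snd mtau).
have mDB : measurable (D @^-1` B) by rewrite -[X in measurable X]setTI; exact: mD.
rewrite nuE; last by rewrite -[X in measurable X]setTI; exact: mj.
have E w : lebesgue_measure (xsection ([set x : S | B ((tau x).2 - x.2)] `&` W) w) =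
    ((\1_(Ap `&` D @^-1` B) w.1 * v w.2)%:E + (u w.1 * \1_(An `&` D @^-1` B) w.2)%:E)%E.
  rewrite inW; case: ifPn => [/andP[h1 h2]|nA].
    have uw : u w.1 = D w.1 by rewrite /u indicE h1 mul1r.
    have vw : v w.2 = - D w.2 by rewrite /v indicE h2 mul1r.
    have -> : xsection [set x : S | B ((tau x).2 - x.2)] w `&` `[0, u w.1 + v w.2[%classic =
        [set z | 0 <= z < u w.1 + v w.2 /\ B (if z < v w.2 then u w.1 else - v w.2)].
      have jE z : (tau (w, z)).2 - z = if z < v w.2 then u w.1 else - v w.2.
        by rewrite /tau /=; case: ifP => _; ring.
      apply/seteqP; split => z.
        by move=> [/xsP /=]; rewrite jE in_itv.
      by move=> [h h']; split; [apply/xsP; rewrite /= jE|rewrite /= in_itv].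
    rewrite lebesgue_measure_exchange_jump// -EFinD.
    rewrite !indicE (in_setI w.1 Ap) (in_setI w.2 An) h1 h2 /= uw vw opprK.
    by [].
  rewrite measure0 -EFinD; congr EFin;
    rewrite /u /v !indicE (in_setI w.1 Ap) (in_setI w.2 An).
  by move: nA; case: (w.1 \in Ap); case: (w.2 \in An) => //= _; rewrite ?mul0r ?mulr0 ?addr0.
under eq_integral do rewrite E.
rewrite ge0_integralD//=; last 4 first.
- by move=> w _; rewrite lee_fin mulr_ge0.
- apply/measurable_EFinP; apply: measurable_funM.
    apply: measurableT_comp => //; apply: measurable_indic; exact: measurableI.
  exact: measurableT_comp.
- by move=> w _; rewrite lee_fin mulr_ge0.
- apply/measurable_EFinP; apply: measurable_funM; first exact: measurableT_comp.
  apply: measurableT_comp => //; apply: measurable_indic; exact: measurableI.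
rewrite (@integral_prod_mul _ _ _ _ _ P P (\1_(Ap `&` D @^-1` B)) v)//; last first.
  by apply: measurable_indic; exact: measurableI.
rewrite (@integral_prod_mul _ _ _ _ _ P P u (\1_(An `&` D @^-1` B)))//; last first.
  by apply: measurable_indic; exact: measurableI.
rewrite !integral_indic//; last 2 first.
- exact: measurableI.
- exact: measurableI.
rewrite !setIT uE vE [X in (_ + X)%E]muleC -ge0_muleDl// -measureU; last 3 first.
- exact: measurableI.
- exact: measurableI.
- apply/seteqP; split => x //= -[[[_ /= h] _] [[_ /= h'] _]].
  by move: h'; rewrite leNgt h.
rewrite muleC -muleA -EFinM mulfV ?gt_eqF// mule1 -setIUl; congr (P (_ `&` _)).
apply/seteqP; split => x; first by move=> [[]|[]].
by move=> Ax; have [h|h] := ltP 0 (D x); [left|right].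
Qed.


Let nuA : nu setT = P A.
Proof.
have := @nu_jump setT measurableT; rewrite preimage_setT setIT => <-.
by congr (nu _); apply/seteqP.
Qed.

Let nuW B : nu (B `&` W) = nu B.
Proof. by rewrite /nu /= /mscale /= /mrestr -setIA setIid. Qed.

Let miter j : measurable_fun setT (iter j tau).
Proof. by elim: j => [|j IH]; [exact: measurable_id|exact: measurableT_comp]. Qed.

Let iterW j x : W x -> W (iter j tau x).
Proof. by move=> Wx; elim: j => //= j; exact: tauW. Qed.

Let nu_iter j B : measurable B -> nu (iter j tau @^-1` B) = nu B.
Proof.
move=> mB; elim: j => [|j IH]; first by [].
rewrite -[RHS]IH -(nu_tau (B := iter j tau @^-1` B)).
  by congr (nu _); apply/seteqP; split => x /=; rewrite -iterS iterSr.
by rewrite -[X in measurable X]setTI; exact: miter.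
Qed.

(** [transfer] wants values in the unit interval everywhere: on [W] the height is at most [2 * M],
    and off [W], which is null for [nu], it is cut to 0. *)
Let F j x : R := \1_W x * ((iter j tau x).2 / (2 * M)).

Let miter2 j : measurable_fun setT (fun x => (iter j tau x).2 : R).
Proof. exact: (measurableT_comp measurable_snd (miter j)). Qed.

Let mF j : measurable_fun setT (F j).
Proof.
apply: measurable_funM; first exact: measurable_indic.
by apply: measurable_funM.
Qed.

Let FW j x : W x -> 2 * M * F j x = (iter j tau x).2.
Proof.
move=> Wx; rewrite /F indicE mem_set// mul1r mulrCA mulfV ?mulr1//.
by rewrite mulf_neq0// gt_eqF.
Qed.

Let F01 j x : 0 <= F j x <= 1.
Proof.
rewrite /F indicE; case: (boolP (x \in W)) => [/set_mem/(iterW j)|_]; last first.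
  by rewrite mul0r lexx ler01.
move=> [_ _ /andP[z0 z1]]; rewrite mul1r.
have uM w : u w <= M.
  rewrite /u indicE; case: (_ \in _); rewrite ?mul0r ?mul1r ?(ltW M0)//.
  by rewrite (le_trans (ler_norm _)).
have vM w : v w <= M.
  rewrite /v indicE; case: (_ \in _); rewrite ?mul0r ?mul1r ?(ltW M0)//.
  by rewrite (le_trans (ler_norm _))// normrN.
rewrite divr_ge0//= ?mulr_ge0 ?(ltW M0)// ler_pdivrMr ?mulr_gt0// mul1r.
rewrite (le_trans (ltW z1))// mulr_natl mulr2n; exact: lerD.
Qed.

Lemma coboundary_chain_pos : exists Z : nat -> T -> R,
  [/\ forall j, measurable_fun setT (Z j), forall j w, 0 <= Z j w <= 2 * M,
    forall j x, P (A `&` [set w | Z j w <= x]) = P (A `&` [set w | Z 0 w <= x]) &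
    forall j x, P (A `&` [set w | Z j.+1 w - Z j w <= x]) = P (A `&` [set w | D w <= x])].
Proof.
have [Z [mZ Z01 ZP]] := transfer P_atomless mA nuA mF F01.
have M20 : 0 <= 2 * M by rewrite mulr_ge0// ltW.
have nZ j x : P (A `&` [set w | 2 * M * Z j w <= x]) = nu [set y : S | (y.2 : R) <= x].
  have /esym := ZP j j (2 * M) 0 x; under eq_set do rewrite mul0r addr0.
  under [in RHS]eq_set do rewrite mul0r addr0.
  move=> <-; rewrite -[LHS]nuW.
  have m2x : measurable [set y : S | (y.2 : R) <= x].
    exact: measurable_set_le.
  rewrite -[RHS](nu_iter j m2x) -[RHS]nuW; congr (nu _).
  by apply/seteqP; split => y [/= h Wy]; split => //; move: h; rewrite /= FW.
exists (fun j w => 2 * M * Z j w); split.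
- by move=> j; exact: measurable_funM.
- move=> j w; have /andP[z0 z1] := Z01 j w.
  by rewrite mulr_ge0//= -[leRHS]mulr1 ler_wpM2l.
- by move=> j x; rewrite !nZ.
- move=> j x; have := ZP j.+1 j (2 * M) (- (2 * M)) x.
  under eq_set do rewrite mulNr.
  under [in RHS]eq_set do rewrite mulNr.
  move=> ->; rewrite -[LHS]nuW.
  have -> : [set w | D w <= x] = D @^-1` `]-oo, x].
    by apply/seteqP; split => y; rewrite /= in_itv.
  rewrite -[RHS](nu_jump (B := `]-oo, x]%classic)); last exact: measurable_itv.
  have mj : measurable [set y : S | `]-oo, x]%classic ((tau y).2 - y.2)].
    have := measurable_funB (miter2 1) (miter2 0).
    by move=> /(_ measurableT `]-oo, x]%classic (measurable_itv _)); rewrite setTI.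
  rewrite -[RHS](nu_iter j mj) -[RHS]nuW; congr (nu _).
  apply/seteqP; split => y [/= h Wy]; split => //; move: h.
    by rewrite !FW//= in_itv.
  by rewrite !FW//= in_itv.
Qed.

End exchange_space.

Section coboundary_chain.
Context d (T : measurableType d) (R : realType) (P : probability T R).
Hypothesis P_atomless : atomless P.

Lemma bounded_integrable (A : set T) (D : T -> R) M : measurable A ->
  measurable_fun setT D -> (forall x, `|D x| <= M) ->
  P.-integrable A (EFin \o D).
Proof.
move=> mA mD DM; apply: (@measurable_bounded_integrable _ _ _ P) => //.
- exact: (le_lt_trans (probability_le1 P mA) (ltry 1)).
- exact: measurable_funTS.
- by exists M; split; [exact: num_real|move=> y My x _ /=; rewrite (le_trans (DM x))// ltW].
Qed.

Lemma prU_le (B1 B2 : set T) : measurable B1 -> measurable B2 ->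
  pr P (B1 `|` B2) <= pr P B1 + pr P B2.
Proof.
move=> m1 m2; rewrite -lee_fin EFinD -!prE//; last exact: measurableU.
exact: measureU2.
Qed.

Lemma pr_eq_null (B1 B2 N : set T) : measurable B1 -> measurable B2 ->
  measurable N -> pr P N = 0 -> B1 `\` N = B2 `\` N -> pr P B1 = pr P B2.
Proof.
move=> m1 m2 mN N0 B12; rewrite (prDI P m1 mN) (prDI P m2 mN) B12; congr (_ + _).
have z B : measurable B -> pr P (B `&` N) = 0.
  move=> mB; apply/le_anti; rewrite pr_ge0 andbT.
  by have := pr_le P (measurableI _ _ mB mN) mN (@subIsetr _ _ _); rewrite N0.
by rewrite !z.
Qed.

Lemma measurable_neq0 (f : T -> R) : measurable_fun setT f -> measurable [set x | f x != 0].
Proof.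
move=> mf; rewrite (_ : [set _ | _] = f @^-1` (~` [set 0])).
  by rewrite -[X in measurable X]setTI; apply: mf => //; exact: measurableC.
by apply/seteqP; split => x /=; [move/eqP|move/eqP].
Qed.

Lemma ge0_integral0_pr (f : T -> R) : measurable_fun setT f -> (forall x, 0 <= f x) ->
  (\int[P]_x (f x)%:E = 0)%E -> pr P [set x | f x != 0] = 0.
Proof.
move=> mf f0 fi.
have /(ae_eq_integral_abs P measurableT) : measurable_fun setT (EFin \o f) by
  exact/measurable_EFinP.
case=> + _; move=> /(_ _)[|N [mN N0 sub]].
  rewrite -[RHS]fi; apply: eq_integral => x _ /=.
  by rewrite ger0_norm.
apply/le_anti; rewrite pr_ge0 andbT.
apply: (@le_trans _ _ (pr P N)); last by rewrite /pr N0.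
apply: pr_le => //; first exact: measurable_neq0.
by move=> x /= /eqP fx; apply: sub => /= /(_ I) [].
Qed.

Lemma coboundary_chain (A : set T) (D : T -> R) M : measurable A ->
  measurable_fun setT D -> 0 < M -> (forall x, `|D x| <= M) ->
  \int[P]_(x in A) D x = 0 ->
  exists Z : nat -> T -> R,
  [/\ forall j, measurable_fun setT (Z j), forall j w, 0 <= Z j w <= 2 * M,
    forall j x, P (A `&` [set w | Z j w <= x]) = P (A `&` [set w | Z 0 w <= x]) &
    forall j x, P (A `&` [set w | Z j.+1 w - Z j w <= x]) = P (A `&` [set w | D w <= x])].
Proof.
move=> mA mD M0 DM D0.
pose Ap := A `&` [set x | 0 < D x].
pose An := A `&` [set x | D x <= 0].
have mAp : measurable Ap by apply: measurableI => //; exact: measurable_set_gt.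
have mAn : measurable An by apply: measurableI => //; exact: measurable_set_le.
pose u x : R := \1_Ap x * D x.
pose v x : R := \1_An x * - D x.
have mu_ : measurable_fun setT u.
  by apply: measurable_funM => //; exact: measurable_indic.
have mv : measurable_fun setT v.
  by apply: measurable_funM; [exact: measurable_indic|exact: measurable_funN].
have ile1 (B : set T) x : `|\1_B x| <= 1 :> R.
  by rewrite indicE; case: (_ \in _); rewrite /= ?normr1 ?normr0.
have iu : P.-integrable setT (EFin \o u).
  apply: (@bounded_integrable _ _ M) => // x.
  by rewrite /u normrM -[leRHS]mul1r ler_pM.
have iv : P.-integrable setT (EFin \o v).
  apply: (@bounded_integrable _ _ M) => // x.
  by rewrite /v normrM normrN -[leRHS]mul1r ler_pM.
pose c := \int[P]_x u x.
have uE : (\int[P]_x (u x)%:E = c%:E)%E.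
  by rewrite /c /Rintegral fineK//; exact: integrable_fin_num.
have cv : c = \int[P]_x v x.
  apply/eqP; rewrite -subr_eq0 -RintegralB//; apply/eqP.
  rewrite -[RHS]D0 [RHS]Rintegral_mkcond; apply: eq_Rintegral => x _.
  rewrite /u /v patchE !indicE (in_setI x A) (in_setI x A).
  case: (x \in A); rewrite ?mul0r ?subr0//=.
  have -> : (x \in [set x | 0 < D x]) = (0 < D x) by apply/idP/idP; rewrite inE.
  have -> : (x \in [set x | D x <= 0]) = (D x <= 0) by apply/idP/idP; rewrite inE.
  by case: ltP => _; rewrite ?mul0r ?mul1r ?subr0 ?sub0r ?opprK.
have vE : (\int[P]_x (v x)%:E = c%:E)%E.
  by rewrite cv /Rintegral fineK//; exact: integrable_fin_num.
have u0 x : 0 <= u x.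
  rewrite /u indicE; case: (boolP (x \in Ap)) => [|_]; last by rewrite mul0r.
  by rewrite inE => -[_ /= /ltW]; rewrite mul1r.
have v0 x : 0 <= v x.
  rewrite /v indicE; case: (boolP (x \in An)) => [|_]; last by rewrite mul0r.
  by rewrite inE => -[_ /=]; rewrite mul1r oppr_ge0.
have c0 : 0 <= c by apply: Rintegral_ge0.
move: c0; rewrite le_eqVlt => /predU1P[c0|c0]; last first.
  exact: (coboundary_chain_pos mA mD M0 DM P_atomless c0 uE vE).
(* The normalisation by [c] breaks down when [c = 0]. Then both parts of [D] have integral zero, [D]
   vanishes almost surely on [A], and the zero chain will do. *)
have zu : pr P [set x | u x != 0] = 0 by apply: ge0_integral0_pr => //; rewrite uE -c0.
have zv : pr P [set x | v x != 0] = 0 by apply: ge0_integral0_pr => //; rewrite vE -c0.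
exists (fun _ => cst 0); split => //.
  by move=> _ w; rewrite lexx mulr_ge0// ltW.
move=> _ x; rewrite !prE//; last 2 first.
- by apply: measurableI => //; exact: measurable_set_le.
- by apply: measurableI => //; apply: measurable_set_le; exact: measurable_funB.
congr EFin; apply: (@pr_eq_null _ _ ([set x | u x != 0] `|` [set x | v x != 0])).
- by apply: measurableI => //; apply: measurable_set_le; exact: measurable_funB.
- by apply: measurableI => //; exact: measurable_set_le.
- by apply: measurableU; exact: measurable_neq0.
- apply/le_anti; rewrite pr_ge0 andbT (le_trans (prU_le _ _))//; try exact: measurable_neq0.
  by rewrite zu zv addr0.
- have D00 w : A w -> ~ ([set x | u x != 0] `|` [set x | v x != 0]) w -> D w = 0.
    move=> Aw /not_orP[/negP/negPn/eqP uw /negP/negPn/eqP vw].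
    case: (ltgtP (D w) 0) => // Dw.
      have /mem_set wA : An w by split => //=; exact: ltW.
      by move: vw; rewrite /v indicE wA mul1r => /eqP; rewrite oppr_eq0 => /eqP.
    have /mem_set wA : Ap w by [].
    by move: uw; rewrite /u indicE wA mul1r.
  apply/seteqP; split => w [[Aw h] nN]; split => //; split => //; move: h => /=.
    by rewrite (D00 _ Aw nN) subrr.
  by rewrite (D00 _ Aw nN) subrr.
Qed.

End coboundary_chain.

(** * Bounded functions and their laws *)

Section bounded.
Context d (T : measurableType d) (R : realType) (P : probability T R).

(** The bound holds everywhere, so that pointwise constructions carry no exceptional set;
    [Linfty_bdd] provides such a representative of every essentially bounded variable. *)
Definition bdd (f : T -> R) :=
  measurable_fun setT f /\ exists M, forall w, `|f w| <= M.

Lemma bddD f g : bdd f -> bdd g -> bdd (fun w => f w + g w).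
Proof.
move=> [mf [M fM]] [mg [N gN]]; split; first exact: measurable_funD.
by exists (M + N) => w; rewrite (le_trans (ler_normD _ _))// lerD.
Qed.

Lemma bddM f g : bdd f -> bdd g -> bdd (fun w => f w * g w).
Proof.
move=> [mf [M fM]] [mg [N gN]]; split; first exact: measurable_funM.
by exists (M * N) => w; rewrite normrM ler_pM.
Qed.

Lemma bdd_cst c : bdd (fun=> c).
Proof. by split; [exact: measurable_cst|exists `|c|]. Qed.

Lemma bddZ c f : bdd f -> bdd (fun w => c * f w).
Proof. by apply: bddM; exact: bdd_cst. Qed.

Lemma bddN f : bdd f -> bdd (fun w => - f w).
Proof.
by move=> [mf [M fM]]; split; [exact: measurable_funN|exists M => w; rewrite normrN].
Qed.

Lemma bddB f g : bdd f -> bdd g -> bdd (fun w => f w - g w).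
Proof. by move=> bf bg; apply: bddD => //; exact: bddN. Qed.

Lemma bdd_indic (A : set T) : measurable A -> bdd (\1_A : T -> R).
Proof.
move=> mA; split; first exact: measurable_indic.
by exists 1 => w; rewrite indicE; case: (_ \in _); rewrite ?normr1 ?normr0.
Qed.

Lemma bdd_sum n (f : nat -> T -> R) : (forall j, bdd (f j)) ->
  bdd (fun w => \sum_(j < n) f j w).
Proof.
move=> bf; elim: n => [|n IH].
  by under eq_fun do rewrite big_ord0; exact: bdd_cst.
by under eq_fun do rewrite big_ord_recr /=; exact: bddD.
Qed.

Lemma bdd_Linfty f : bdd f -> exists X : Linfty P, forall w, X w = f w.
Proof.
move=> [mf [M fM]].
have fin : finite_norm P +oo%E f.
  rewrite /finite_norm unlock /Lnorm; case: ifPn => // _.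
  apply: (@le_lt_trans _ _ M%:E); last exact: ltry.
  by apply: ess_sup_ler => w /=; rewrite lee_fin.
have fL : f \in Lfun P +oo%E by apply/andP; split; rewrite inE.
by exists (Lfun_Sub (leey 1%E) fL).
Qed.

Definition same_law (f g : T -> R) :=
  forall x, P [set w | f w <= x] = P [set w | g w <= x].

Lemma same_law_sym f g : same_law f g -> same_law g f.
Proof. by move=> fg x; rewrite fg. Qed.

Lemma same_law_trans f g h : same_law f g -> same_law g h -> same_law f h.
Proof. by move=> fg gh x; rewrite fg gh. Qed.

Lemma same_law_in_law (X Y : {RV P >-> R}) : same_law X Y -> eq_in_law P X Y.
Proof.
move=> XY B mB; rewrite /distribution /pushforward.
apply: (@eq_law_rays _ _ _ _ _ P P X Y) => //.
exact: (le_lt_trans (probability_le1 P measurableT) (ltry 1)).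
Qed.

Lemma in_law_same_law (X Y : {RV P >-> R}) : eq_in_law P X Y -> same_law X Y.
Proof.
by move=> XY x; exact: (XY `]-oo, x]%classic (measurable_itv _)).
Qed.

Lemma same_law_null (f g : T -> R) : measurable_fun setT f -> measurable_fun setT g ->
  pr P [set w | f w - g w != 0] = 0 -> same_law f g.
Proof.
move=> mf mg fg0 x; rewrite !prE; [|exact: measurable_set_le|exact: measurable_set_le].
congr EFin; apply: (@pr_eq_null _ _ _ _ _ _ [set w | f w - g w != 0]) => //.
- exact: measurable_set_le.
- exact: measurable_set_le.
- by apply: measurable_neq0; exact: measurable_funB.
- have E w : ~ [set w | f w - g w != 0] w -> f w = g w.
    by move=> /negP/negPn; rewrite subr_eq0 => /eqP.
  by apply/seteqP; split => w [/= h /[dup] /E fgw]; split => //; move: h; rewrite fgw.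
Qed.

Lemma Linfty_bdd (X : Linfty P) : exists2 f, bdd f & pr P [set w | X w - f w != 0] = 0.
Proof.
have : finite_norm P +oo%E X by exact: Lfunction_finite.
rewrite /finite_norm unlock /Lnorm; case: ifPn => [_|/negP[]]; last first.
  apply: (@lt_le_trans _ _ 1%E); first exact: lte01.
  by rewrite le_eqVlt; apply/orP; left; apply/eqP; exact: (esym (probability_setT P)).
move=> /ess_supr_bounded[M [N [mN N0 sub]]].
have mX : measurable_fun setT X by [].
exists (fun w => Num.max (- `|M|) (Num.min `|M| (X w))).
  split; first by apply: measurable_maxr => //; exact: measurable_minr.
  exists `|M| => w; rewrite ler_norml le_max lexx /= ge_max ge_min lexx /= andbT.
  by rewrite (le_trans _ (normr_ge0 M))// oppr_le0.
apply/le_anti; rewrite pr_ge0 andbT.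
apply: (@le_trans _ _ (pr P N)); last by rewrite /pr N0.
apply: pr_le => //.
  apply: measurable_neq0; apply: measurable_funB => //.
  by apply: measurable_maxr => //; exact: measurable_minr.
move=> w /= /eqP h; apply: sub => /= XM; apply: h.
have : `|X w| <= `|M| by rewrite (le_trans XM)// ler_norm.
rewrite ler_norml => /andP[h1 h2].
by rewrite (min_r h2) (max_r h1) subrr.
Qed.

End bounded.

(** * Quantiles and tail events *)

Section quantile.
Context d (T : measurableType d) (R : realType) (P : probability T R).
Implicit Types (f g : T -> R) (A : set T).

Definition quantile f (s : R) : R := inf [set x : R | (s%:E <= P [set w | (f w <= x)%R])%E].

Lemma pr_le_right f (a x : R) : measurable_fun setT f ->
  (forall e, 0 < e -> a <= pr P [set w | f w <= x + e]) -> a <= pr P [set w | f w <= x].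
Proof.
move=> mf H; rewrite -lee_fin -prE; last exact: measurable_set_le.
apply: (@le_measure_right _ _ _ P f) => //.
  exact: (le_lt_trans (probability_le1 P measurableT) (ltry 1)).
move=> k; have /H : 0 < k.+1%:R^-1 :> R by rewrite invr_gt0.
by rewrite -lee_fin -prE//; exact: measurable_set_le.
Qed.

(** Galois connection between quantile and distribution function: right continuity makes the infimum
    attained. *)
Lemma quantile_le f s x : bdd f -> 0 < s <= 1 ->
  (quantile f s <= x) = (s <= pr P [set w | f w <= x]).
Proof.
move=> [mf [M fM]] /andP[s0 s1].
pose S := [set x : R | (s%:E <= P [set w | (f w <= x)%R])%E].
have SE y : S y <-> s <= pr P [set w | f w <= y].
  by rewrite /S /= prE ?lee_fin//; exact: measurable_set_le.
have lbS : lbound S (- M).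
  move=> y /SE sy; rewrite leNgt; apply/negP => yM.
  move: sy; rewrite (_ : [set _ | _] = set0) ?pr0 ?leNgt ?s0//.
  apply/seteqP; split => w //= fy.
  have := fM w; rewrite ler_norml => /andP[h _].
  by move: (le_lt_trans (le_trans h fy) yM); rewrite ltxx.
have iS : has_inf S.
  split; last by exists (- M).
  exists M; apply/SE; rewrite (_ : [set _ | _] = setT) ?prT//.
  by apply/seteqP; split => w //= _; rewrite (le_trans (ler_norm _)).
apply/idP/idP => [qx|sx]; last by apply: ge_inf; [case: iS|apply/SE].
apply: pr_le_right => // e e0.
have [y /SE Sy yq] := inf_adherent e0 iS.
apply: (le_trans Sy); apply: pr_le; [exact: measurable_set_le|exact: measurable_set_le|].
by move=> w /= /le_trans; apply; rewrite ltW// (lt_le_trans yq)// lerD2r.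
Qed.

Lemma quantile_same_law f g s : same_law P f g -> quantile f s = quantile g s.
Proof. by move=> fg; rewrite /quantile; under eq_set do rewrite fg. Qed.

(** Tail events with an explicit threshold, up to null sets. Thresholds add and scale along with the
    functions, which makes a common tail event stable under sums and nonnegative multiples. *)
Definition separates A v f :=
  pr P (A `&` [set w | f w < v]) = 0 /\ pr P (~` A `&` [set w | v < f w]) = 0.

Lemma separates_ptw A v f : (forall w, A w -> v <= f w) -> (forall w, ~ A w -> f w <= v) ->
  separates A v f.
Proof.
move=> vf fv; split; rewrite (_ : _ `&` _ = set0) ?pr0//; apply/seteqP; split => w //=.
  by move=> [/vf]; rewrite leNgt => /negP.
by move=> [/fv]; rewrite leNgt => /negP.
Qed.

Hypothesis P_atomless : atomless P.

(** The mass strictly above the [p]-quantile is at most [1 - p], the mass at or above it at least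
    [1 - p]; atomlessness cuts the missing part out of the level set. *)
Lemma exists_separates f p : bdd f -> 0 < p < 1 ->
  exists A v, [/\ measurable A, pr P A = 1 - p, (forall w, A w -> v <= f w) &
    forall w, ~ A w -> f w <= v].
Proof.
move=> bf /andP[p0 p1]; have [mf _] := bf; pose v := quantile f p.
have p01 : 0 < p <= 1 by rewrite p0 ltW.
have mle x := measurable_set_le x mf.
have mlt x := measurable_set_lt x mf.
have pv : p <= pr P [set w | f w <= v] by rewrite -quantile_le.
(* Left limits of the distribution function are handled by right continuity for [- f]. *)
have vp : pr P [set w | f w < v] <= p.
  rewrite -lerN2 -(lerD2l 1) -pr_setC//.
  rewrite (_ : ~` _ = [set w | - f w <= - v]); last first.
    by apply/seteqP; split => w /=; rewrite lerN2 leNgt => /negP.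
  apply: pr_le_right => [|e e0]; first exact: measurable_funN.
  apply: (@le_trans _ _ (pr P (~` [set w | f w <= v - e]))).
    rewrite pr_setC// lerD2l lerN2 ltW// ltNge -quantile_le// -ltNge -/v.
    by rewrite ltrBlDr ltrDl.
  apply: pr_le; [exact: measurableC|by apply: measurable_set_le; exact: measurable_funN|].
  by move=> w /= /negP; rewrite -ltNge => h; lra.
pose C := ~` [set w | f w <= v]; pose E := [set w | f w <= v] `\` [set w | f w < v].
have mC : measurable C by exact: measurableC.
have mE : measurable E by exact: measurableD.
have [|B [mB BE PB]] := @atomless_subset _ _ _ _ P_atomless E (1 - p - pr P C) mE.
  rewrite pr_setC// prD//; last by move=> w /= /ltW.
  by apply/andP; split; lra.
exists (C `|` B), v; split; first exact: measurableU.
  rewrite prU// ?PB; first by ring.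
  by apply/seteqP; split => w //= [nC /BE[]].
- move=> w [nC|/BE[_ nv]]; rewrite leNgt; apply/negP => // wv.
  by apply: nC => /=; exact: ltW.
- move=> w /not_orP[h _]; rewrite leNgt; apply/negP => wv; apply: h => /=.
  by apply/negP; rewrite -ltNge.
Qed.

Lemma separates_tail A v p (X : {RV P >-> R}) : 0 < p < 1 -> measurable A ->
  pr P A = 1 - p -> separates A v X -> p_tail_event P p X A.
Proof.
move=> /andP[p0 p1] mA PA [h1 h2]; split; last by rewrite prE// PA.
split => //.
  by rewrite prE// PA !lte_fin subr_gt0 p1 ltrBlDr ltrDl p0.
have mX : measurable_fun setT X by [].
have m1 : measurable (A `&` [set w | X w < v]) by apply: measurableI => //;
  exact: measurable_set_lt.
have m2 : measurable (~` A `&` [set w | v < X w]).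
  by apply: measurableI; [exact: measurableC|exact: measurable_set_gt].
exists ((A `&` [set w | X w < v]) `|` (~` A `&` [set w | v < X w])).
  exists ((A `&` [set w | X w < v]) `|` (~` A `&` [set w | v < X w])); split => //.
    exact: measurableU.
  rewrite prE; last exact: measurableU.
  by congr EFin; apply/le_anti; rewrite pr_ge0 (le_trans (prU_le _ _ _))// h1 h2 addr0.
move=> w w' Aw Aw' /not_orP[n1 _] /not_orP[_ n2].
apply: (@le_trans _ _ v).
  by rewrite leNgt; apply/negP => h; apply: n2; split.
by rewrite leNgt; apply/negP => h; apply: n1; split.
Qed.

(** The infimum of [X] over [A] off the exceptional set is a threshold; it is finite because [A] and
    its complement, of positive mass, both have points off that set. *)
Lemma tail_separates A p (X : {RV P >-> R}) : p_tail_event P p X A ->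
  exists v, [/\ measurable A, pr P A = 1 - p & separates A v X].
Proof.
move=> [[mA /andP[A0 A1] [N [N' [mN' N'0 NN']] H]] PA].
have PN' : pr P N' = 0 by rewrite /pr N'0.
have [w0 [Aw0 Nw0]] : exists w, A w /\ ~ N w.
  apply: contrapT => /forallNP h; have : A `<=` N'.
    by move=> w Aw; apply: NN'; apply: contrapT => nN; exact: (h w).
  move=> /(pr_le P mA mN'); rewrite PN' => h0.
  by move: A0; rewrite prE// lte_fin ltNge h0.
have [w1 [Aw1 Nw1]] : exists w, ~ A w /\ ~ N w.
  apply: contrapT => /forallNP h; have : ~` A `<=` N'.
    by move=> w Aw; apply: NN'; apply: contrapT => nN; exact: (h w).
  move=> /(pr_le P (measurableC mA) mN'); rewrite PN' pr_setC// => h0.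
  by move: A1; rewrite prE// lte_fin => h1; move: h0; rewrite leNgt subr_gt0 h1.
pose S := [set X w | w in A `\` N].
have lbS w : ~ A w -> ~ N w -> lbound S (X w).
  by move=> Aw Nw _ [w' [Aw' Nw'] <-]; exact: H.
have iS : has_inf S by split; [exists (X w0), w0|exists (X w1); exact: lbS].
have mX : measurable_fun setT X by [].
exists (inf S); split => //; first by rewrite /pr PA.
have null B : measurable B -> B `<=` N -> pr P B = 0.
  move=> mB BN; apply/le_anti; rewrite pr_ge0 andbT -PN' pr_le//.
  exact: subset_trans NN'.
split; apply: null.
- by apply: measurableI => //; exact: measurable_set_lt.
- move=> w [Aw /= wS]; apply: contrapT => Nw; move: wS; rewrite ltNge => /negP; apply.
  by apply: ge_inf; [case: iS|exists w].
- by apply: measurableI; [exact: measurableC|exact: measurable_set_gt].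
- move=> w [Aw /= wS]; apply: contrapT => Nw; move: wS; rewrite ltNge => /negP; apply.
  by apply: lb_le_inf; [case: iS|exact: lbS].
Qed.

End quantile.

(** * Pasting functions along an event, and stability of tail events *)

Section piecewise_fun.
Context d (T : measurableType d) (R : realType) (P : probability T R).
Implicit Types (f g : T -> R) (A : set T).

Definition piecewise A f g : T -> R := fun w => \1_A w * f w + \1_(~` A) w * g w.

Lemma piecewiseT A f g w : A w -> piecewise A f g w = f w.
Proof.
move=> Aw; rewrite /piecewise !indicE (mem_set Aw) mul1r memNset ?mul0r ?addr0//.
Qed.

Lemma piecewiseF A f g w : ~ A w -> piecewise A f g w = g w.
Proof.
by move=> Aw; rewrite /piecewise !indicE (memNset Aw) mul0r (mem_set (Aw : (~` A) w))
  mul1r add0r.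
Qed.

Lemma bdd_piecewise A f g : measurable A -> bdd f -> bdd g -> bdd (piecewise A f g).
Proof.
move=> mA bf bg; apply: bddD; apply: bddM => //; apply: bdd_indic => //.
exact: measurableC.
Qed.

Definition same_law_on A f g :=
  forall x, P (A `&` [set w | f w <= x]) = P (A `&` [set w | g w <= x]).

Lemma same_law_piecewise A f g : measurable A -> measurable_fun setT f ->
  measurable_fun setT g ->
  same_law_on A f g -> same_law_on (~` A) f g -> same_law P f g.
Proof.
move=> mA mf mg h1 h2 x.
have E f' : measurable_fun setT f' -> P [set w | f' w <= x] =
    (P (A `&` [set w | (f' w <= x)%R]) + P (~` A `&` [set w | (f' w <= x)%R]))%E.
  move=> mf'; have ms := measurable_set_le x mf'; have mC := measurableC mA.
  rewrite !prE//; try by apply: measurableI.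
  by rewrite (prDI P ms mA) -EFinD setIC setDE [X in _ + pr P X]setIC.
by rewrite !E// h1 h2.
Qed.

(** Separation only concerns the laws on [A] and on its complement, so a rearrangement within each
    piece inherits the tail event. *)
Lemma separates_same_law_on A f g v : measurable A ->
  measurable_fun setT f -> measurable_fun setT g ->
  same_law_on A f g -> same_law_on (~` A) f g ->
  separates P A v f -> separates P A v g.
Proof.
move=> mA mf mg.
have L A' (mA' : measurable A') : same_law_on A' f g -> forall B : set R, measurable B ->
    pr P (A' `&` f @^-1` B) = pr P (A' `&` g @^-1` B).
  move=> h B mB; rewrite /pr ![A' `&` _]setIC; congr fine.
  apply: (@eq_law_rays _ _ _ _ _ (mrestr P mA') (mrestr P mA') f g) => //.
    by apply: (le_lt_trans _ (ltry 1)); rewrite /= /mrestr setTI; exact: probability_le1.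
  by move=> x; rewrite /= /mrestr /= ![_ `&` A']setIC; exact: h.
have E f' : [set w | f' w < v] = f' @^-1` `]-oo, v[.
  by apply/seteqP; split => w /=; rewrite in_itv.
have E' f' : [set w | v < f' w] = f' @^-1` `]v, +oo[.
  by apply/seteqP; split => w /=; rewrite in_itv/= andbT.
move=> h1 h2; rewrite /separates !E !E' => -[s1 s2]; split.
  by rewrite -[RHS]s1; apply/esym; apply: L.
by rewrite -[RHS]s2; apply/esym; apply: L => //; exact: measurableC.
Qed.

Lemma separatesD A f g v u : measurable A ->
  measurable_fun setT f -> measurable_fun setT g ->
  separates P A v f -> separates P A u g -> separates P A (v + u) (fun w => f w + g w).
Proof.
move=> mA mf mg [f1 f2] [g1 g2]; have mC := measurableC mA.
have mfg : measurable_fun setT (fun w => f w + g w) by exact: measurable_funD.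
split; apply/le_anti; rewrite pr_ge0 andbT.
  rewrite -[leRHS](addr0 0) -{1}f1 -g1.
  apply: (le_trans _ (prU_le _ _ _)); try by apply: measurableI => //;
    exact: measurable_set_lt.
  apply: pr_le; try (by apply: measurableI => //; exact: measurable_set_lt).
    by apply: measurableU; apply: measurableI => //; exact: measurable_set_lt.
  move=> w [Aw /= h]; have [fv|vf] := ltP (f w) v; first by left.
  by right; split => //=; lra.
rewrite -[leRHS](addr0 0) -{1}f2 -g2.
apply: (le_trans _ (prU_le _ _ _)); try by apply: measurableI => //; exact: measurable_set_gt.
apply: pr_le; try (by apply: measurableI => //; exact: measurable_set_gt).
  by apply: measurableU; apply: measurableI => //; exact: measurable_set_gt.
move=> w [Aw /= h]; have [fv|vf] := ltP v (f w); first by left.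
by right; split => //=; lra.
Qed.

Lemma separatesZ A f v c : 0 <= c -> separates P A v f -> separates P A (c * v) (fun w
  => c * f w).
Proof.
rewrite le_eqVlt => /predU1P[<- _|c0 [h1 h2]].
  by apply: separates_ptw => w _; rewrite !mul0r.
rewrite /separates; split.
  by rewrite -[RHS]h1; congr (pr _ (_ `&` _)); apply/seteqP; split => w /=; rewrite ltr_pM2l.
by rewrite -[RHS]h2; congr (pr _ (_ `&` _)); apply/seteqP; split => w /=; rewrite ltr_pM2l.
Qed.

Lemma separates_sum A n (f : nat -> T -> R) v : measurable A ->
  (forall j, measurable_fun setT (f j)) -> (forall j, separates P A v (f j)) ->
  separates P A (n%:R * v) (fun w => \sum_(j < n) f j w).
Proof.
move=> mA mf sf; elim: n => [|n IH].
  by apply: separates_ptw => w _; rewrite big_ord0 mul0r.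
under eq_fun do rewrite big_ord_recr /=.
rewrite -natr1 mulrDl mul1r; apply: separatesD => //.
by apply: measurable_sum.
Qed.

Lemma separates_null A f g v : measurable A ->
  measurable_fun setT f -> measurable_fun setT g ->
  pr P [set w | f w - g w != 0] = 0 -> separates P A v f -> separates P A v g.
Proof.
move=> mA mf mg fg0.
have E B : measurable B -> same_law_on B f g.
  move=> mB x; rewrite !prE; try by apply: measurableI => //; exact: measurable_set_le.
  congr EFin; apply: (@pr_eq_null _ _ _ _ _ _ [set w | f w - g w != 0]) => //;
    try by apply: measurableI => //; exact: measurable_set_le.
    by apply: measurable_neq0; exact: measurable_funB.
  have E' w : ~ [set w | f w - g w != 0] w -> f w = g w.
    by move=> /negP/negPn; rewrite subr_eq0 => /eqP.
  by apply/seteqP; split => w [[Bw /= h] /[dup] /E' fgw] nfg; split => //;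
    split => //; move: h; rewrite /= fgw.
by apply: separates_same_law_on => //; apply: E => //; exact: measurableC.
Qed.

End piecewise_fun.

(** * Concentration averse functionals *)

Section rho.
Context d (T : measurableType d) (R : realType) (P : probability T R).
Hypothesis P_atomless : atomless P.
Variables (p : R) (p01 : 0 < p < 1).
Variable rho : Linfty P -> \bar R.
Hypothesis pca : p_concentration_aversion p rho.

Lemma Linfty_separates (X : Linfty P) : exists A v,
  [/\ measurable A, pr P A = 1 - p & separates P A v X].
Proof.
have [f bf Xf] := Linfty_bdd X.
have [A [v [mA PA h1 h2]]] := exists_separates P_atomless bf p01.
exists A, v; split => //; apply: (@separates_null _ _ _ _ _ f) => //.
- by case: bf.
- rewrite -[RHS]Xf; congr (pr _ _); apply/seteqP; split => w /=.
    by rewrite -opprB oppr_eq0.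
  by rewrite -opprB oppr_eq0.
- exact: separates_ptw.
Qed.

Lemma rho_same_law (X Y : Linfty P) : same_law P X Y -> rho X = rho Y.
Proof.
have le (X' Y' : Linfty P) : same_law P X' Y' -> (rho X' <= rho Y')%E.
  move=> XY; rewrite -[X']addr0 -[Y']addr0; apply: pca.
  - have [A [v [mA PA sA]]] := Linfty_separates Y'.
    exists A; split; first exact: separates_tail sA.
    by apply: (@separates_tail _ _ _ _ _ 0) => //; exact: separates_ptw.
  - exact: same_law_in_law.
  - exact: same_law_in_law.
by move=> XY; apply/le_anti/andP; split; apply: le => //; exact: same_law_sym.
Qed.

(* Junk if no essentially bounded variable has the law of [f]. *)
Definition rho_fun (f : T -> R) := rho (xget 0 [set X : Linfty P | same_law P X f]).

Lemma rho_funE (X : Linfty P) f : same_law P X f -> rho X = rho_fun f.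
Proof.
move=> Xf; apply: rho_same_law; case: xgetP => [Y _ /= Yf|/(_ X)/(_ Xf)//].
by apply: same_law_trans Xf _; exact: same_law_sym.
Qed.

Lemma rho_fun_same_law f g : bdd f -> same_law P f g -> rho_fun f = rho_fun g.
Proof.
move=> /(bdd_Linfty P)[X Xf] fg.
have Xf' : same_law P X f by move=> x; under eq_set do rewrite Xf.
by rewrite -(rho_funE Xf'); apply: rho_funE; exact: same_law_trans fg.
Qed.

Lemma rho_fun_le A v v' f g f' g' : measurable A -> pr P A = 1 - p ->
  bdd f -> bdd g -> bdd f' -> bdd g' -> separates P A v f' -> separates P A v' g' ->
  same_law P f f' -> same_law P g g' ->
  (rho_fun (fun w => (f w + g w)%R) <= rho_fun (fun w => (f' w + g' w)%R))%E.
Proof.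
move=> mA PA /(bdd_Linfty P)[X XE] /(bdd_Linfty P)[Y YE].
move=> /(bdd_Linfty P)[X' XE'] /(bdd_Linfty P)[Y' YE'].
have -> : f = X by apply/funext => w; rewrite XE.
have -> : g = Y by apply/funext => w; rewrite YE.
have -> : f' = X' by apply/funext => w; rewrite XE'.
have -> : g' = Y' by apply/funext => w; rewrite YE'.
move=> s1 s2 l1 l2.
rewrite -(@rho_funE (X + Y))// -(@rho_funE (X' + Y'))//; apply: pca.
- by exists A; split; apply: separates_tail; eassumption.
- exact: same_law_in_law.
- exact: same_law_in_law.
Qed.

Lemma rho_fun_eq A v v' A' u u' f g f' g' : measurable A -> pr P A = 1 - p ->
  measurable A' -> pr P A' = 1 - p ->
  bdd f -> bdd g -> bdd f' -> bdd g' ->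
  separates P A v f -> separates P A v' g ->
  separates P A' u f' -> separates P A' u' g' ->
  same_law P f f' -> same_law P g g' ->
  rho_fun (fun w => f w + g w) = rho_fun (fun w => f' w + g' w).
Proof.
move=> mA PA mA' PA' bf bg bf' bg' s1 s2 s3 s4 l1 l2; apply/le_anti/andP; split.
  exact: (rho_fun_le mA' PA' bf bg bf' bg' s3 s4).
by apply: (rho_fun_le mA PA bf' bg' bf bg s1 s2); exact: same_law_sym.
Qed.

End rho.

(** * Replacement of a variable by its conditional means *)

Section mean.
Context d (T : measurableType d) (R : realType) (P : probability T R).
Implicit Types (f g : T -> R) (A : set T).

Lemma bdd_integrable A f : measurable A -> bdd f -> P.-integrable A (EFin \o f).
Proof. by move=> mA [mf [M fM]]; exact: bounded_integrable fM. Qed.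

Lemma Rintegral_cst_pr A c : measurable A -> \int[P]_(w in A) c = c * pr P A.
Proof. by move=> mA; rewrite Rintegral_cst. Qed.

Lemma Rintegral_subc A f c : measurable A -> bdd f ->
  \int[P]_(w in A) (f w - c) = \int[P]_(w in A) f w - c * pr P A.
Proof.
move=> mA bf; rewrite RintegralB//; try exact: bdd_integrable.
  by rewrite Rintegral_cst_pr.
by apply: bdd_integrable => //; exact: bdd_cst.
Qed.

Lemma Rintegral_piecewise A f g : measurable A -> bdd f -> bdd g ->
  \int[P]_w piecewise A f g w = \int[P]_(w in A) f w + \int[P]_(w in ~` A) g w.
Proof.
move=> mA bf bg; have mC := measurableC mA.
rewrite -(setUv A) Rintegral_setU//=.
- congr (_ + _); apply: eq_Rintegral => w /set_mem; first exact: piecewiseT.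
  exact: piecewiseF.
- by rewrite setUv; apply: bdd_integrable => //; exact: bdd_piecewise.
- by apply/disj_setPCl.
Qed.

Lemma piecewise_coboundary A f a b : atomless P -> measurable A -> bdd f ->
  \int[P]_(w in A) f w = a * pr P A ->
  \int[P]_(w in ~` A) f w = b * pr P (~` A) ->
  exists K (Z : nat -> T -> R), [/\ 0 < K, forall j, bdd (Z j),
    forall j w, (A w -> 0 <= Z j w <= K) /\ (~ A w -> - K <= Z j w <= 0),
    forall j, same_law P (Z j) (Z 0) &
    forall j, same_law_on P A (fun w => piecewise A (cst a) (cst b) w + (Z j.+1 w - Z j
      w)) f /\
      same_law_on P (~` A) (fun w => piecewise A (cst a) (cst b) w + (Z j.+1 w - Z j w)) f].
Proof.
move=> P_atomless mA bf fa fb; have mC := measurableC mA.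
have [mf [N fN]] := bf.
pose M := `|N| + `|a| + `|b| + 1.
have M0 : 0 < M by rewrite ltr_wpDl// !addr_ge0.
have aM w : `|f w - a| <= M.
  have := fN w; have := ler_norm N; have := normr_ge0 b; have := ler_normB (f w) a.
  by rewrite /M; lra.
have bM w : `|f w - b| <= M.
  have := fN w; have := ler_norm N; have := normr_ge0 a; have := ler_normB (f w) b.
  by rewrite /M; lra.
have mfa c : measurable_fun setT (fun w => f w - c) by exact: measurable_funB.
have ia : \int[P]_(w in A) (f w - a) = 0 by rewrite Rintegral_subc// fa subrr.
have ib : \int[P]_(w in ~` A) (f w - b) = 0 by rewrite Rintegral_subc// fb subrr.
have [Z1 [mZ1 Z1M Z1l Z1d]] := coboundary_chain P_atomless mA (mfa a) M0 aM ia.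
have [Z2 [mZ2 Z2M Z2l Z2d]] := coboundary_chain P_atomless mC (mfa b) M0 bM ib.
pose K := 2 * M; have K0 : 0 < K by rewrite mulr_gt0.
have bZ1 j : bdd (Z1 j).
  by split => //; exists K => w; have /andP[h1 h2] := Z1M j w; rewrite ger0_norm.
have bZ2 j : bdd (Z2 j).
  by split => //; exists K => w; have /andP[h1 h2] := Z2M j w; rewrite ger0_norm.
(* The shift by [- K] leaves the increments alone and makes [A] a tail event of every [Z j], with
   threshold 0. *)
pose Z j := piecewise A (Z1 j) (fun w => Z2 j w - K).
have bZ j : bdd (Z j).
  by apply: bdd_piecewise => //; apply: bddB => //; exact: bdd_cst.
exists K, Z; split => //.
- move=> j w; split=> Aw; first by rewrite /Z piecewiseT//; exact: Z1M.
  rewrite /Z piecewiseF//; have /andP[h1 h2] := Z2M j w.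
  by apply/andP; split; rewrite -/K in h2 *; lra.
- move=> j; apply: (same_law_piecewise mA); [by case: (bZ j)|by case: (bZ 0%N)| |] => x.
    have E k : A `&` [set w | Z k w <= x] = A `&` [set w | Z1 k w <= x].
      by apply/seteqP; split => w [Aw /=]; rewrite /Z piecewiseT.
    by rewrite !E Z1l.
  have E k : ~` A `&` [set w | Z k w <= x] = ~` A `&` [set w | Z2 k w <= x + K].
    by apply/seteqP; split => w [Aw /=]; rewrite /Z piecewiseF// lerBlDr.
  by rewrite !E Z2l.
- move=> j; split=> x.
    have -> : A `&` [set w | piecewise A (cst a) (cst b) w + (Z j.+1 w - Z j w) <= x] =
        A `&` [set w | Z1 j.+1 w - Z1 j w <= x - a].
      by apply/seteqP; split => w [Aw /= h]; split => //; move: h;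
        rewrite /= /Z !piecewiseT//= lerBrDl.
    by rewrite Z1d; congr (P (_ `&` _)); apply/seteqP; split => w /=; rewrite lerD2r.
  have -> : ~` A `&` [set w | piecewise A (cst a) (cst b) w + (Z j.+1 w - Z j w) <= x] =
      ~` A `&` [set w | Z2 j.+1 w - Z2 j w <= x - b].
    by apply/seteqP; split => w [Aw /= h]; split => //; move: h;
      rewrite /= /Z !piecewiseF//=; lra.
  by rewrite Z2d; congr (P (_ `&` _)); apply/seteqP; split => w /=; rewrite lerD2r.
Qed.

Hypothesis P_atomless : atomless P.
Variables (p : R) (p01 : 0 < p < 1).
Variable rho : Linfty P -> \bar R.
Hypothesis pca : p_concentration_aversion p rho.
Let r := rho_fun rho.

Let r_eq A v v' u u' f g f' g' : measurable A -> pr P A = 1 - p ->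
  bdd f -> bdd g -> bdd f' -> bdd g' ->
  separates P A v f -> separates P A v' g ->
  separates P A u f' -> separates P A u' g' ->
  same_law P f f' -> same_law P g g' ->
  r (fun w => f w + g w) = r (fun w => f' w + g' w).
Proof.
by move=> mA PA *; apply: (rho_fun_eq P_atomless p01 pca mA PA mA PA); eassumption.
Qed.

(** Hybrid argument: [f] is a sum of [n] copies of [f / n], and these are exchanged for [F j / n]
    one at a time. [A] is a tail event of what stays in place, so each exchange is between
    concentrated pairs. *)
Lemma rho_fun_average A f v (F : nat -> T -> R) n : measurable A -> pr P A = 1 - p ->
  bdd f -> separates P A v f -> (forall j, bdd (F j)) ->
  (forall j, separates P A v (F j)) -> (forall j, same_law P f (F j)) -> (0 < n)%N ->
  r f = r (fun w => n%:R^-1 * \sum_(j < n) F j w).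
Proof.
move=> mA PA bf sf bF sF fF n0.
have n0' : n%:R != 0 :> R by rewrite pnatr_eq0 -lt0n.
pose H k w := n%:R^-1 * \sum_(j < k) F j w + (n - k)%:R / n%:R * f w.
have Hk k : (k < n)%N -> r (H k) = r (H k.+1).
  move=> kn; pose rest w := n%:R^-1 * \sum_(j < k) F j w + (n - k.+1)%:R / n%:R * f w.
  have E1 : H k = fun w => rest w + n%:R^-1 * f w.
    apply/funext => w; rewrite /H /rest -addrA; congr (_ + _).
    by rewrite -mulrDl -[X in _ + X]mul1r -mulrDl natr1 subnSK.
  have E2 : H k.+1 = fun w => rest w + n%:R^-1 * F k w.
    by apply/funext => w; rewrite /H /rest big_ord_recr /= mulrDr addrAC.
  have brest : bdd rest.
    by apply: bddD; apply: bddZ => //; exact: bdd_sum.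
  have srest : separates P A (n%:R^-1 * (k%:R * v) + (n - k.+1)%:R / n%:R * v) rest.
    have mS : measurable_fun setT (fun w => \sum_(j < k) F j w) by case: (bdd_sum k bF).
    apply: separatesD => //.
    - by apply: measurable_funM.
    - by apply: measurable_funM => //; case: bf.
    - apply: (@separatesZ _ _ _ _ _ (fun w => \sum_(j < k) F j w)) => //.
      by apply: separates_sum => // j; case: (bF j).
    - exact: separatesZ.
  rewrite E1 E2; apply: (r_eq mA PA _ _ _ _ srest _ srest) => //.
  - exact: bddZ.
  - exact: bddZ.
  - by apply: separatesZ sf.
  - by apply: separatesZ (sF k).
  - move=> x.
    have E g : [set w | n%:R^-1 * g w <= x] = [set w | g w <= n%:R * x] :> set T.
      by apply/seteqP; split => w /=; rewrite ler_pdivrMl// ltr0n.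
    by rewrite !E (fF k).
have H0 : H 0%N = f.
  by apply/funext => w; rewrite /H big_ord0 mulr0 add0r subn0 divff// mul1r.
have Hn : H n = fun w => n%:R^-1 * \sum_(j < n) F j w.
  by apply/funext => w; rewrite /H subnn mul0r mul0r addr0.
rewrite -Hn -[in LHS]H0; move: (leqnn n); move: {-2}n => k.
elim: k => // k IH kn; rewrite IH; last exact: ltnW.
exact: Hk.
Qed.

Lemma rho_fun_mean A f v a b : measurable A -> pr P A = 1 - p -> bdd f ->
  (forall w, A w -> v <= f w) -> (forall w, ~ A w -> f w <= v) ->
  \int[P]_(w in A) f w = a * pr P A ->
  \int[P]_(w in ~` A) f w = b * pr P (~` A) ->
  r f = r (piecewise A (cst a) (cst b)).
Proof.
move=> mA PA bf fA fB fa fb; have mC := measurableC mA.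
have /andP[p0 p1] := p01.
have PA0 : 0 < pr P A by rewrite PA subr_gt0.
have PC0 : 0 < pr P (~` A) by rewrite pr_setC// PA opprB addrCA subrr addr0.
have sf : separates P A v f by exact: separates_ptw.
have bg : bdd (piecewise A (cst a) (cst b)) by apply: bdd_piecewise => //; exact: bdd_cst.
have [mf _] := bf; have [mg _] := bg.
have va : v <= a.
  rewrite -(ler_pM2r PA0) -fa -Rintegral_cst_pr//; apply: le_Rintegral => //.
  - by apply: bdd_integrable => //; exact: bdd_cst.
  - exact: bdd_integrable.
have bv : b <= v.
  rewrite -(ler_pM2r PC0) -fb -Rintegral_cst_pr//; apply: le_Rintegral => //.
  - exact: bdd_integrable.
  - by apply: bdd_integrable => //; exact: bdd_cst.
(* Because [b <= v <= a], the case [a <= b] means that all three agree. There is no gap to absorb a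
   perturbation, but [f] is almost surely [v]: its distance [h] to [v] has integral zero. *)
have [ab|ba] := leP a b.
  have av : a = v by lra.
  have {}bv : b = v by lra.
  apply: (rho_fun_same_law P_atomless p01 pca) => //; apply: same_law_null => //.
  pose h := piecewise A (fun w => f w - v) (fun w => v - f w).
  have bh : bdd h by apply: bdd_piecewise => //; apply: bddB => //; exact: bdd_cst.
  have h0 w : 0 <= h w.
    by rewrite /h; have [Aw|Aw] := pselect (A w); [rewrite piecewiseT|rewrite piecewiseF];
      rewrite // subr_ge0; [exact: fA|exact: fB].
  have hi : \int[P]_w h w = 0.
    rewrite Rintegral_piecewise//; try by apply: bddB => //; exact: bdd_cst.
    rewrite Rintegral_subc// fa av subrr add0r RintegralB//.
    - by rewrite Rintegral_cst_pr// fb bv subrr.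
    - by apply: bdd_integrable => //; exact: bdd_cst.
    - exact: bdd_integrable.
  have hi' : (\int[P]_w (h w)%:E = 0)%E.
    rewrite -[LHS]fineK; first by congr EFin; exact: hi.
    by apply: integrable_fin_num => //; exact: bdd_integrable.
  have [mh _] := bh.
  rewrite -[RHS](ge0_integral0_pr mh h0 hi'); congr (pr _ _).
  apply/seteqP; split => w /=; have [Aw|Aw] := pselect (A w);
    rewrite /h ?(piecewiseT _ _ Aw) ?(piecewiseF _ _ Aw) /= ?av ?bv//.
    by rewrite -opprB oppr_eq0.
  by rewrite -opprB oppr_eq0.
have [K [Z [K0 bZ ZAC Zl Zd]]] := piecewise_coboundary P_atomless mA bf fa fb.
have ZA j w := (ZAC j w).1; have ZC j w := (ZAC j w).2.
pose F j w := piecewise A (cst a) (cst b) w + (Z j.+1 w - Z j w).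
have bF j : bdd (F j) by apply: bddD => //; exact: bddB.
have mF j : measurable_fun setT (F j) by case: (bF j).
have fF j : same_law P f (F j).
  by apply/same_law_sym; have [h1 h2] := Zd j; exact: (same_law_piecewise mA).
have sF j : separates P A v (F j).
  apply: (@separates_same_law_on _ _ _ _ _ f) => //.
    by have [h _] := Zd j => x; rewrite h.
  by have [_ h] := Zd j => x; rewrite h.
(* Chosen so that [b + K / n <= a - K / n]: subtracting [Z 0 / n] from the two-valued variable then
   keeps [A] a tail event. *)
pose n := (Num.bound (2 * K / (a - b))).+1.
have ab0 : 0 < a - b by rewrite subr_gt0.
have n0 : 0 < n%:R :> R by rewrite ltr0n.
have nK : 2 * (n%:R^-1 * K) <= a - b.
  rewrite mulrCA ler_pdivrMl//  -ler_pdivrMr//.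
  rewrite (le_trans (ltW (archi_boundP _)))// ?ler_nat//.
  by rewrite divr_ge0 ?mulr_ge0// ltW.
rewrite (rho_fun_average mA PA bf sf bF sF fF (n := n))//.
have SF k w : \sum_(j < k) F j w = k%:R * piecewise A (cst a) (cst b) w + (Z k w - Z 0 w).
  elim: k => [|k IH]; first by rewrite big_ord0 mul0r subrr addr0.
  by rewrite big_ord_recr /= IH /F -natr1; ring.
pose Y w := piecewise A (cst a) (cst b) w - n%:R^-1 * Z 0 w.
have -> : (fun w => n%:R^-1 * \sum_(j < n) F j w) = fun w => Y w + n%:R^-1 * Z n w.
  by apply/funext => w; rewrite SF /Y; field; rewrite gt_eqF.
have -> : piecewise A (cst a) (cst b) = fun w => Y w + n%:R^-1 * Z 0 w.
  by apply/funext => w; rewrite /Y subrK.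
have sZ j : separates P A 0 (fun w => n%:R^-1 * Z j w).
  apply: separates_ptw => w Aw.
    by have /andP[h _] := ZA j w Aw; rewrite mulr_ge0// invr_ge0 ltW.
  by have /andP[_ h] := ZC j w Aw; rewrite pmulr_rle0// invr_gt0.
have sY : separates P A (a - n%:R^-1 * K) Y.
  apply: separates_ptw => w Aw; rewrite /Y.
    rewrite piecewiseT//= lerD2l lerN2 ler_pM2l ?invr_gt0//.
    by have /andP[_ ->] := ZA 0 w Aw.
  rewrite piecewiseF//=.
  have /andP[h _] := ZC 0 w Aw.
  have : n%:R^-1 * (- K) <= n%:R^-1 * Z 0 w by rewrite ler_pM2l ?invr_gt0.
  by rewrite mulrN; lra.
have bY : bdd Y by apply: bddB => //; exact: bddZ.
apply: (r_eq mA PA bY _ bY _ sY (sZ n) sY (sZ 0%N)) => //.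
- exact: bddZ.
- exact: bddZ.
- move=> x.
  have E j : [set w | n%:R^-1 * Z j w <= x] = [set w | Z j w <= n%:R * x].
    by apply/seteqP; split => w /=; rewrite ler_pdivrMl.
  by rewrite !E Zl.
Qed.

End mean.

(** * Expected shortfall *)

Section expected_shortfall.
Context d (T : measurableType d) (R : realType) (P : probability T R).
Implicit Types (f g : T -> R) (A : set T).

Lemma Rintegral_null A f g : measurable A ->
  measurable_fun setT f -> measurable_fun setT g ->
  pr P [set w | f w - g w != 0] = 0 -> \int[P]_(w in A) f w = \int[P]_(w in A) g w.
Proof.
move=> mA mf mg fg0; rewrite /Rintegral; congr fine; apply: ae_eq_integral => //.
- by apply/measurable_EFinP; exact: measurable_funTS.
- by apply/measurable_EFinP; exact: measurable_funTS.
- have mN : measurable [set w | f w - g w != 0].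
    by apply: measurable_neq0; exact: measurable_funB.
  exists [set w | f w - g w != 0]; split => //; first by have := prE P mN; rewrite fg0.
  move=> w /= h; apply/negP => /eqP/subr0_eq fg; apply: h => _.
  by rewrite fg.
Qed.

Lemma measurable_fun_posB f v : measurable_fun setT f ->
  measurable_fun setT (fun w => Num.max (f w - v) 0).
Proof. by move=> mf; apply: measurable_maxr => //; exact: measurable_funB. Qed.

Lemma bdd_posB f v : bdd f -> bdd (fun w => Num.max (f w - v) 0).
Proof.
move=> [mf [M fM]]; split; first exact: measurable_fun_posB.
exists (M + `|v|) => w; have := fM w; have := ler_normB (f w) v; have := normr_ge0 v.
by case: (leP (f w - v) 0) => _; rewrite ?normr0; have := normr_ge0 (f w); lra.
Qed.

(** On the tail event [f - v] agrees with its positive part, and off it the positive part vanishes,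
    almost surely. *)
Lemma Rintegral_separates A f v : measurable A -> bdd f -> separates P A v f ->
  \int[P]_(w in A) f w = \int[P]_w Num.max (f w - v) 0 + v * pr P A.
Proof.
move=> mA bf [s1 s2]; have [mf _] := bf.
have mC := measurableC mA.
have bfv : bdd (fun w => f w - v) by apply: bddB => //; exact: bdd_cst.
have bp : bdd (piecewise A (fun w => f w - v) (cst 0)).
  by apply: bdd_piecewise => //; exact: bdd_cst.
have [mp _] := bp; have [mq _] := bdd_posB v bf.
rewrite (@Rintegral_null _ _ (piecewise A (fun w => f w - v) (cst 0)) _ mq mp)//.
  rewrite Rintegral_piecewise//; last exact: bdd_cst.
  by rewrite Rintegral_subc// Rintegral_cst_pr// mul0r addr0 subrK.
apply/le_anti; rewrite pr_ge0 andbT.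
have m1 : measurable (A `&` [set w | f w < v]).
  by apply: measurableI => //; exact: measurable_set_lt.
have m2 : measurable (~` A `&` [set w | v < f w]).
  by apply: measurableI => //; exact: measurable_set_gt.
apply: (@le_trans _ _ (pr P ((A `&` [set w | f w < v]) `|` (~` A `&` [set w | v < f
  w])))); last first.
  by rewrite (le_trans (prU_le _ m1 m2))// s1 s2 addr0.
apply: pr_le.
- by apply: measurable_neq0; exact: measurable_funB.
- exact: measurableU.
move=> w /=; have [Aw|Aw] := pselect (A w).
  rewrite piecewiseT//=; case: (leP (f w - v) 0) => // h; last by rewrite subrr eqxx.
  move=> ne; left; split => //=; rewrite lt_neqAle -subr_le0 h andbT.
  by apply: contraNneq ne => ->; rewrite !subrr.
rewrite piecewiseF//=; case: (leP (f w - v) 0) => // h; first by rewrite subrr eqxx.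
by move=> _; right; split => //=; rewrite -subr_gt0.
Qed.

(** For an arbitrary event the positive part merely dominates; hence tail events maximise the
    integral of [f] among events of equal mass. *)
Lemma Rintegral_le_posB B f v : measurable B -> bdd f ->
  \int[P]_(w in B) f w <= \int[P]_w Num.max (f w - v) 0 + v * pr P B.
Proof.
move=> mB bf; rewrite -lerBlDr -Rintegral_subc//.
have bfv : bdd (fun w => f w - v) by apply: bddB => //; exact: bdd_cst.
rewrite [leLHS]Rintegral_mkcond; apply: le_Rintegral => //.
- have := bdd_integrable P mB bfv; rewrite (integrable_mkcond _ mB).
  by rewrite restrict_EFin.
- by apply: bdd_integrable => //; exact: bdd_posB.
- move=> w _; rewrite patchE; case: ifP => _; first by rewrite le_max lexx.
  by rewrite le_max lexx orbT.
Qed.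

Definition ESfun p f : R :=
  (1 - p)^-1 * \int[lebesgue_measure]_(s in `]p, 1[) quantile P f s.

Lemma ESfunE p (X : {RV P >-> R}) : ES P p X = ESfun p X.
Proof. by []. Qed.

Let I01 : set R := `]0, 1[%classic.

Lemma quantile_nondecreasing f s t : bdd f -> 0 < s -> s <= t -> t <= 1 ->
  quantile P f s <= quantile P f t.
Proof.
move=> bf s0 st t1; rewrite quantile_le ?s0 ?(le_trans st)//.
by rewrite -quantile_le// t1 (lt_le_trans s0).
Qed.

Lemma quantile_bound f M s : bdd f -> (forall w, `|f w| <= M) -> 0 < s <= 1 ->
  `|quantile P f s| <= M.
Proof.
move=> bf fM s01; have /andP[s0 s1] := s01; rewrite ler_norml; apply/andP; split.
  rewrite leNgt; apply/negP => qM.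
  have := lexx (quantile P f s); rewrite {1}quantile_le//.
  rewrite (_ : [set _ | _] = set0) ?pr0 ?leNgt ?s0//.
  apply/seteqP; split => w //= fy.
  have := fM w; rewrite ler_norml => /andP[h _].
  by move: (le_lt_trans (le_trans h fy) qM); rewrite ltxx.
rewrite quantile_le// (_ : [set _ | _] = setT) ?prT//.
by apply/seteqP; split => w //= _; rewrite (le_trans (ler_norm _)).
Qed.

Lemma measurable_quantile f : bdd f -> measurable_fun I01 (quantile P f).
Proof.
move=> bf; have mD : measurable I01 by exact: measurable_itv.
apply: (measurability (@measurable_realfun.RGenCInfty.G R)) => [|/= _ [_] [r] -> <-].
  exact: measurable_realfun.RGenCInfty.measurableE.
apply: is_interval_measurable => s t /= [].
rewrite /I01 /= !in_itv/= !andbT => /andP[s0 s1] qs [/andP[t0 t1] qt] u /andP[su ut].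
have u0 := lt_le_trans s0 su; have u1 := le_lt_trans ut t1.
split; first by rewrite in_itv/= u0 u1.
by rewrite in_itv/= andbT (le_trans qs)// quantile_nondecreasing// ltW.
Qed.

(** Quantile transform: under Lebesgue measure on the unit interval the quantile function has the
    law of [f]. *)
Lemma Rintegral_quantile_posB f v : bdd f ->
  \int[lebesgue_measure]_(s in I01) Num.max (quantile P f s - v) 0 =
  \int[P]_w Num.max (f w - v) 0.
Proof.
move=> bf; have [mf _] := bf.
have mI : measurable I01 by exact: measurable_itv.
have mq := measurable_quantile bf.
pose q := quantile P f \_ I01.
have mq' : measurable_fun setT q by exact/(measurable_restrictT _ mI).
have qE s : I01 s -> q s = quantile P f s by move=> /mem_set Is; rewrite /q patchE Is.
pose lam := mrestr (@lebesgue_measure R) mI.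
have lamB (B : set R) : measurable B -> lam (q @^-1` B) = P (f @^-1` B).
  have lamT : lam setT = 1%E.
    by rewrite /lam /mrestr setTI lebesgue_measure_itv/= lte01 oppr0 adde0.
  apply: (@eq_law_rays _ _ _ _ _ lam P q f) => //.
  - apply: (@eq_ind_r _ 1%E (fun z => z < +oo)%E (ltry 1)); exact: lamT.
  - exact: (etrans lamT (esym (probability_setT P))).
  move=> x.
  have EP : P (f @^-1` `]-oo, x]) = (pr P [set w | f w <= x])%:E.
    by rewrite -prE//; exact: measurable_set_le.
  transitivity ((pr P [set w | f w <= x])%:E); last by rewrite -EP.
  change (lebesgue_measure ((q @^-1` `]-oo, x]) `&` I01) = (pr P [set w | f w <= x])%:E).
  set F := pr P _.
  have F0 : 0 <= F by exact: pr_ge0.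
  have F1 : F <= 1 by rewrite -(prT P) pr_le//; exact: measurable_set_le.
  have iff s : I01 s -> (q s <= x) = (s <= F).
    move=> Is; rewrite qE// quantile_le//; move: Is; rewrite /I01 /= in_itv/=.
    by move=> /andP[-> /ltW].
  (* The levels up to [F] form []0, F]], except that for [F = 1] the right end is missing from the
     open unit interval. *)
  have [F1'|F1'] := ltP F 1.
    rewrite (_ : _ `&` _ = `]0, F]%classic).
      by rewrite lebesgue_measure_itv/= lte_fin; case: ltP => F0';
        [rewrite oppr0 adde0|congr EFin; lra].
    apply/seteqP; split => s.
      move=> [/= + Is]; rewrite in_itv/= iff// => sF; move: Is; rewrite /I01 /= !in_itv/=.
      by move=> /andP[-> _].
    rewrite /= in_itv/= => /andP[s0 sF].
    have Is : I01 s by rewrite /I01 /= in_itv/= s0 (le_lt_trans sF).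
    by split => //; rewrite in_itv/= iff.
  rewrite (_ : _ `&` _ = I01).
    rewrite lebesgue_measure_itv/= lte01 oppr0 adde0; congr EFin; lra.
  apply/seteqP; split => s; first by move=> [].
  move=> Is; split => //; rewrite /= in_itv/= iff//.
  by move: Is; rewrite /I01 /= in_itv/= => /andP[_ s1]; lra.
pose h (x : R) : \bar R := (Num.max (x - v) 0)%:E.
have mh : measurable_fun setT h.
  by apply/measurable_EFinP; apply: measurable_maxr => //; exact: measurable_funB.
have h0 x : (0 <= h x)%E by rewrite lee_fin le_max lexx orbT.
have mq2 : measurable_fun (setT : set (measurableTypeR R)) (q : measurableTypeR R -> R) by [].
pose q_ : {mfun measurableTypeR R >-> R} :=
  HB.pack (q : measurableTypeR R -> R) (isMeasurableFun.Build _ _ (measurableTypeR R) _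
    _ mq2).
pose f_ : {mfun T >-> R} := mfun_Sub (mem_set mf).
rewrite /Rintegral; congr fine.
transitivity (\int[P]_w h (f w))%E; last by [].
have := @ge0_integral_pushforward _ _ _ _ R f_ (measurable_funPT f_) P setT h
  measurableT mh (fun y _ => h0 y).
rewrite preimage_setT => <-.
transitivity (\int[pushforward lam q_]_y h y)%E; last first.
  by apply: eq_measure_integral => B mB _; exact: lamB.
rewrite (@ge0_integral_pushforward _ _ _ _ R q_ (measurable_funPT q_) lam setT h
  measurableT mh (fun y _ => h0 y)).
have mhq : measurable_fun setT (h \o q) by exact: (measurableT_comp mh mq').
have mC : measurable (~` I01) by exact: measurableC.
rewrite preimage_setT -(setUv I01) ge0_integral_setU//=.
- rewrite [X in (_ + X)%E](_ : _ = 0%E); last first.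
    apply: null_set_integral => //=; first exact: (measurable_funTS mhq).
    by rewrite /mrestr /= setICl measure0.
  rewrite adde0; transitivity (\int[lebesgue_measure]_(s in I01) h (q s))%E.
    by apply: eq_integral => s /set_mem Is; rewrite qE.
  apply: eq_measure_integral => B mB BI.
  by rewrite /= /mrestr (setIidl BI).
- by rewrite setUv.
- by apply/disj_setPCl.
Qed.

(** The Rockafellar-Uryasev formula at an arbitrary [p]-quantile [v]: quantiles at levels above [p]
    are at least [v], those at levels up to [p] at most [v], so restricting to []p, 1[] amounts to
    taking the positive part of the quantile minus [v]. *)
Lemma ESfun_posB p f v : 0 < p < 1 -> bdd f ->
  p <= pr P [set w | f w <= v] -> pr P [set w | f w < v] <= p ->
  (1 - p) * ESfun p f = \int[P]_w Num.max (f w - v) 0 + v * (1 - p).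
Proof.
move=> /andP[p0 p1] bf pv vp; have [mf [M fM]] := bf.
rewrite /ESfun mulrA mulfV ?mul1r ?subr_eq0 ?gt_eqF//.
rewrite -Rintegral_quantile_posB//.
have mq := measurable_quantile bf.
pose J : set R := `]p, 1[%classic.
have mJ : measurable J by exact: measurable_itv.
have JI : J `<=` I01.
  by move=> s; rewrite /J /I01 /= !in_itv/= => /andP[/(lt_trans p0) -> ->].
have lamJ : lebesgue_measure J = (1 - p)%:E.
  by rewrite lebesgue_measure_itv/= lte_fin p1 EFinB.
have lamy : (lebesgue_measure J < +oo)%E by rewrite lamJ ltry.
have iq : (@lebesgue_measure R).-integrable J (EFin \o quantile P f).
  apply: measurable_bounded_integrable => //.
  - exact: (measurable_funS (measurable_itv _) JI mq).
  - exists M; split; first exact: num_real.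
    move=> y My s /JI; rewrite /I01 /= in_itv/= => /andP[s0 s1].
    by rewrite (le_trans (quantile_bound bf fM _)) ?s0 ?ltW.
have ic c : (@lebesgue_measure R).-integrable J (EFin \o cst c).
  apply: measurable_bounded_integrable => //.
  - by exists `|c|; split; [exact: num_real|move=> y My s _; exact: ltW].
transitivity (\int[lebesgue_measure]_(s in J) (quantile P f s - v) + v * (1 - p)).
  rewrite RintegralB//; last exact: ic.
  rewrite [X in _ = _ - X + _](_ : _ = v * (1 - p)) ?subrK//.
  by rewrite Rintegral_cst//; congr (_ * _); exact: (congr1 fine lamJ).
congr (_ + _).
have -> : J = I01 `&` J by rewrite setIidr.
rewrite Rintegral_mkcondr; apply: eq_Rintegral => s /set_mem Is.
have /andP[s0 s1] : 0 < s < 1 by move: Is; rewrite /I01 /= in_itv.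
have s01 : 0 < s <= 1 by rewrite s0 ltW.
rewrite patchE; case: ifPn => [/set_mem|/negP nJ].
  rewrite /J /= in_itv/= => /andP[ps _].
  rewrite max_l// subr_ge0 leNgt; apply/negP => qv.
  have := lexx (quantile P f s); rewrite {1}quantile_le// => sq.
  have : pr P [set w | f w <= quantile P f s] <= pr P [set w | f w < v].
    apply: pr_le; [exact: measurable_set_le|exact: measurable_set_lt|].
    by move=> w /= /le_lt_trans; exact.
  by lra.
rewrite [LHS](_ : _ = 0)// max_r// subr_le0 quantile_le//.
apply: le_trans pv; rewrite leNgt; apply/negP => ps; apply: nJ.
by rewrite inE /J /= in_itv/= ps.
Qed.

Lemma separates_pr p A f v : measurable A -> measurable_fun setT f ->
  pr P A = 1 - p -> separates P A v f ->
  p <= pr P [set w | f w <= v] /\ pr P [set w | f w < v] <= p.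
Proof.
move=> mA mf PA [s1 s2]; have mC := measurableC mA.
have ml := measurable_set_le v mf; have ml' := measurable_set_lt v mf.
have PC : pr P (~` A) = p by rewrite pr_setC// PA; ring.
split.
  rewrite -PC (prDI P mC (measurableC ml)).
  rewrite (_ : ~` A `&` ~` _ = ~` A `&` [set w | v < f w]); last first.
    by apply/seteqP; split => w [Aw /=]; [move=> /negP; rewrite -ltNge|move=> h;
      split => //; apply/negP; rewrite -ltNge].
  rewrite s2 add0r; apply: pr_le => //; first by apply: measurableD => //; exact: measurableC.
  by move=> w [_ /= /contrapT].
rewrite (prDI P ml' mA) setIC s1 add0r -PC; by apply: pr_le => //; exact: measurableD.
Qed.

Lemma ESfun_separates p A f v : 0 < p < 1 -> measurable A -> pr P A = 1 - p ->
  bdd f -> separates P A v f -> (1 - p) * ESfun p f = \int[P]_(w in A) f w.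
Proof.
move=> p01 mA PA bf sf; have [mf _] := bf.
have [h1 h2] := separates_pr mA mf PA sf.
by rewrite (ESfun_posB p01 bf h1 h2) (Rintegral_separates mA bf sf) PA.
Qed.

Hypothesis P_atomless : atomless P.

(** ES is the largest mean over events of mass [1 - p], attained at tail events; subadditivity and
    monotonicity come from this. *)
Lemma ESfun_ge p B f : 0 < p < 1 -> measurable B -> pr P B = 1 - p ->
  bdd f -> \int[P]_(w in B) f w <= (1 - p) * ESfun p f.
Proof.
move=> p01 mB PB bf; have [mf _] := bf.
have [A [v [mA PA h1 h2]]] := exists_separates P_atomless bf p01.
have [h3 h4] := separates_pr mA mf PA (separates_ptw P h1 h2).
by rewrite (ESfun_posB p01 bf h3 h4) -PB; exact: Rintegral_le_posB.
Qed.

End expected_shortfall.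

(** * Law invariance, subadditivity and additivity of expected shortfall *)

Section functionals.
Context d (T : measurableType d) (R : realType) (P : probability T R).
Implicit Types (f g : T -> R) (A : set T).

Lemma Rintegral_bddD A f g : measurable A -> bdd f -> bdd g ->
  \int[P]_(w in A) (f w + g w) = \int[P]_(w in A) f w + \int[P]_(w in A) g w.
Proof. by move=> mA bf bg; rewrite RintegralD//; exact: bdd_integrable. Qed.

Lemma RintegralZD A a f g : measurable A -> bdd f -> bdd g ->
  \int[P]_(w in A) (a * f w + g w) =
  a * \int[P]_(w in A) f w + \int[P]_(w in A) g w.
Proof.
move=> mA bf bg; rewrite (Rintegral_bddD mA (bddZ a bf) bg) RintegralZl//.
exact: bdd_integrable.
Qed.

Lemma Rintegral_indic_pr A B : measurable A -> measurable B ->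
  \int[P]_(w in A) \1_B w = pr P (B `&` A) :> R.
Proof. by move=> mA mB; rewrite /Rintegral integral_indic. Qed.

Lemma Rintegral_setC A f : measurable A -> bdd f ->
  \int[P]_w f w = \int[P]_(w in A) f w + \int[P]_(w in ~` A) f w.
Proof.
move=> mA bf; rewrite -Rintegral_piecewise//; apply: eq_Rintegral => w _.
by have [Aw|Aw] := pselect (A w); [rewrite piecewiseT|rewrite piecewiseF].
Qed.

(** With the threshold [- K] below both ranges the positive part is [f + K], so the quantile
    transform already gives law invariance of the mean. *)
Lemma Rintegral_same_law f g : bdd f -> bdd g -> same_law P f g ->
  \int[P]_w f w = \int[P]_w g w.
Proof.
move=> bf bg fg; have [_ [M fM]] := bf; have [_ [N gN]] := bg.
pose K := `|M| + `|N|.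
have E h : bdd h -> (forall w, `|h w| <= K) ->
    \int[P]_w h w = \int[P]_w Num.max (h w - - K) 0 - K.
  move=> bh hK; apply/esym/eqP; rewrite subr_eq.
  have {2}-> : K = \int[P]_(w in setT) K by rewrite Rintegral_cst_pr// prT mulr1.
  apply/eqP; rewrite -(Rintegral_bddD measurableT bh (bdd_cst _ K)).
  apply: eq_Rintegral => w _; rewrite opprK max_l//.
  by have := hK w; rewrite ler_norml => /andP[h1 _]; lra.
have fK w : `|f w| <= K.
  by rewrite (le_trans (fM w))// (le_trans (ler_norm _))// /K lerDl.
have gK w : `|g w| <= K.
  by rewrite (le_trans (gN w))// (le_trans (ler_norm _))// /K lerDr.
rewrite (E f bf fK) (E g bg gK) -(Rintegral_quantile_posB P _ bf)
  -(Rintegral_quantile_posB P _ bg).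
apply: (congr1 (fun z => z - K)).
by apply: eq_Rintegral => s _; rewrite (quantile_same_law _ fg).
Qed.

Lemma ESfun_same_law p f g : same_law P f g -> ESfun P p f = ESfun P p g.
Proof.
by move=> fg; congr (_ * _); apply: eq_Rintegral => s _; exact: quantile_same_law.
Qed.

Lemma same_law_piecewise_cst A A' a b : measurable A -> measurable A' ->
  pr P A = pr P A' ->
  same_law P (piecewise A (cst a) (cst b)) (piecewise A' (cst a) (cst b)).
Proof.
move=> mA mA' AA' x.
have E B : measurable B -> pr P [set w | piecewise B (cst a) (cst b) w <= x] =
    (a <= x)%R%:R * pr P B + (b <= x)%R%:R * (1 - pr P B).
  move=> mB; case: (boolP (a <= x)) => ax; case: (boolP (b <= x)) => bx.
  - rewrite (_ : [set _ | _] = setT) ?prT; first by rewrite ?mulr1n ?mulr0n; ring.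
    by apply/seteqP; split => w //= _; have [Bw|Bw] := pselect (B w);
      [rewrite piecewiseT|rewrite piecewiseF].
  - rewrite (_ : [set _ | _] = B); first by rewrite ?mulr1n ?mulr0n; ring.
    apply/seteqP; split => w /=; have [Bw|Bw] := pselect (B w) => //.
    + by rewrite piecewiseF//= (negbTE bx).
    + by rewrite piecewiseT.
  - rewrite (_ : [set _ | _] = ~` B) ?pr_setC//; first by rewrite ?mulr1n ?mulr0n; ring.
    apply/seteqP; split => w /=; have [Bw|Bw] := pselect (B w) => //.
    + by rewrite piecewiseT//= (negbTE ax).
    + by rewrite piecewiseF.
  - rewrite (_ : [set _ | _] = set0) ?pr0; first by rewrite ?mulr1n ?mulr0n; ring.
    by apply/seteqP; split => w //=; have [Bw|Bw] := pselect (B w);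
      [rewrite piecewiseT//= (negbTE ax)|rewrite piecewiseF//= (negbTE bx)].
have mp (B : set T) : measurable B -> measurable [set w | piecewise B (cst a) (cst b) w <= x].
  move=> mB; apply: measurable_set_le.
  by have [] := bdd_piecewise mB (bdd_cst _ a) (bdd_cst _ b).
by rewrite !prE; [rewrite !E// AA'|exact: mp|exact: mp].
Qed.

Lemma Linfty_represented p (X : Linfty P) f : bdd f ->
  pr P [set w | X w - f w != 0] = 0 ->
  [/\ same_law P X f, ES P p X = ESfun P p f & fine ('E_P[X])%E = \int[P]_w f w].
Proof.
move=> [mf _] Xf; have Xf' : same_law P X f by exact: same_law_null.
split; [exact: Xf'|by rewrite ESfunE; exact: ESfun_same_law|].
by rewrite expectation.unlock; exact: Rintegral_null.
Qed.

Hypothesis P_atomless : atomless P.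
Variables (p : R) (p01 : 0 < p < 1).

Let p1 : 0 < 1 - p. Proof. by case/andP: p01 => _; rewrite subr_gt0. Qed.

(** The threshold of a tail event lies between the mean off it and ES. This places the pair of ES
    and mean in the half-plane. *)
Lemma Rintegral_le_ESfun f : bdd f -> \int[P]_w f w <= ESfun P p f.
Proof.
move=> bf; have /andP[p0 _] := p01.
have [A [v [mA PA fA fB]]] := exists_separates P_atomless bf p01.
have mC := measurableC mA.
have EA := ESfun_separates p01 mA PA bf (separates_ptw P fA fB).
have vA : v * (1 - p) <= \int[P]_(w in A) f w.
  rewrite -PA -Rintegral_cst_pr//; apply: le_Rintegral => //; try exact: bdd_integrable.
  by apply: bdd_integrable => //; exact: bdd_cst.
have vB : \int[P]_(w in ~` A) f w <= v * p.
  rewrite (_ : p = pr P (~` A)); last by rewrite pr_setC// PA; ring.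
  rewrite -Rintegral_cst_pr//; apply: le_Rintegral => //; try exact: bdd_integrable.
  by apply: bdd_integrable => //; exact: bdd_cst.
have vES : v <= ESfun P p f by rewrite -(ler_pM2l p1) EA mulrC.
have : v * p <= ESfun P p f * p by rewrite ler_pM2r.
by rewrite (Rintegral_setC mA bf) -EA; lra.
Qed.

Lemma ESfun_subadditive f g : bdd f -> bdd g ->
  ESfun P p (fun w => f w + g w) <= ESfun P p f + ESfun P p g.
Proof.
move=> bf bg; have bfg := bddD bf bg.
have [A [v [mA PA fA fB]]] := exists_separates P_atomless bfg p01.
rewrite -(ler_pM2l p1) (ESfun_separates p01 mA PA bfg (separates_ptw P fA fB)).
rewrite (Rintegral_bddD mA bf bg).
by rewrite mulrDr lerD// ESfun_ge.
Qed.

Lemma ESfun_additive A v u f g : measurable A -> pr P A = 1 - p -> bdd f -> bdd g ->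
  separates P A v f -> separates P A u g ->
  ESfun P p (fun w => f w + g w) = ESfun P p f + ESfun P p g.
Proof.
move=> mA PA bf bg sf sg; apply: (mulfI (lt0r_neq0 p1)).
have [mf _] := bf; have [mg _] := bg.
rewrite mulrDr (ESfun_separates p01 mA PA bf sf) (ESfun_separates p01 mA PA bg sg).
rewrite (ESfun_separates p01 mA PA (bddD bf bg) (separatesD mA mf mg sf sg)).
exact: Rintegral_bddD.
Qed.

Lemma le_ESfun f g : bdd f -> bdd g -> (forall w, f w <= g w) ->
  ESfun P p f <= ESfun P p g.
Proof.
move=> bf bg fg; rewrite -(ler_pM2l p1).
have [A [v [mA PA fA fB]]] := exists_separates P_atomless bf p01.
rewrite (ESfun_separates p01 mA PA bf (separates_ptw P fA fB)).
apply: le_trans (ESfun_ge P_atomless p01 mA PA bg).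
by apply: le_Rintegral => //; exact: bdd_integrable.
Qed.

(** * From the representation to concentration aversion and monotonicity *)

Section represented.
Variables (rho : Linfty P -> \bar R) (F : R -> R -> \bar R).
Hypotheses (F_first : increasing_in_first F) (rhoF : represented_by p rho F).

Lemma represented_concentration_aversion : p_concentration_aversion p rho.
Proof.
move=> X Y X' Y' [A [tX tY]] XX' YY'; rewrite !rhoF.
have [f bf Xf] := Linfty_bdd X; have [g bg Yg] := Linfty_bdd Y.
have [f' bf' Xf'] := Linfty_bdd X'; have [g' bg' Yg'] := Linfty_bdd Y'.
have add (U V : Linfty P) h k : bdd h -> bdd k -> pr P [set w | U w - h w != 0] = 0 ->
    pr P [set w | V w - k w != 0] = 0 ->
    pr P [set w | (U + V) w - (h w + k w) != 0] = 0.
  move=> [mh _] [mk _] Uh Vk.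
  have mU : measurable_fun setT U by [].
  have mV : measurable_fun setT V by [].
  have m1 : measurable [set w | U w - h w != 0] by apply: measurable_neq0;
    exact: measurable_funB.
  have m2 : measurable [set w | V w - k w != 0] by apply: measurable_neq0;
    exact: measurable_funB.
  apply/le_anti; rewrite pr_ge0 andbT.
  apply: (@le_trans _ _ (pr P ([set w | U w - h w != 0] `|` [set w | V w - k w != 0]))).
    apply: pr_le; [|exact: measurableU|].
      apply: measurable_neq0; apply: measurable_funB;
        [exact: measurable_funD|exact: measurable_funD].
    move=> w /=; rewrite opprD addrACA.
    by case: (eqVneq (U w) (h w)) => [->|Uw]; [rewrite subrr add0r; right|left;
      rewrite subr_eq0].
  by rewrite (le_trans (prU_le _ _ _))// Uh Vk addr0.
have [lX EX IX] := Linfty_represented p bf Xf.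
have [lY EY IY] := Linfty_represented p bg Yg.
have [lX' EX' IX'] := Linfty_represented p bf' Xf'.
have [lY' EY' IY'] := Linfty_represented p bg' Yg'.
have [_ -> ->] := Linfty_represented p (bddD bf bg) (add _ _ _ _ bf bg Xf Yg).
have [_ -> ->] := Linfty_represented p (bddD bf' bg') (add _ _ _ _ bf' bg' Xf' Yg').
have ff' : same_law P f f'.
  apply: same_law_trans (same_law_sym lX) _; apply: same_law_trans lX'.
  exact: in_law_same_law.
have gg' : same_law P g g'.
  apply: same_law_trans (same_law_sym lY) _; apply: same_law_trans lY'.
  exact: in_law_same_law.
have -> : \int[P]_w (f' w + g' w) = \int[P]_w (f w + g w).
  rewrite (Rintegral_bddD measurableT bf bg) (Rintegral_bddD measurableT bf' bg').
  by rewrite (Rintegral_same_law bf bf' ff') (Rintegral_same_law bg bg' gg').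
apply: F_first; first exact: Rintegral_le_ESfun (bddD bf bg).
have [v [mA PA sX]] := tail_separates tX.
have [u [_ _ sY]] := tail_separates tY.
have [mf' _] := bf'; have [mg' _] := bg'.
have sf' : separates P A v f' by apply: separates_null sX.
have sg' : separates P A u g' by apply: separates_null sY.
rewrite (ESfun_additive mA PA bf' bg' sf' sg').
rewrite -(ESfun_same_law p ff') -(ESfun_same_law p gg'); exact: ESfun_subadditive.
Qed.

Lemma represented_monotonicity : increasing_in_second F -> monotonicity rho.
Proof.
move=> F_second X Y XY; rewrite !rhoF.
have [f0 bf0 Xf0] := Linfty_bdd X; have [g bg Yg] := Linfty_bdd Y.
(* Bounded representatives need not be ordered pointwise; the minimum with [g] is, and it still
   represents [X] because [X <= Y]. *)
pose f w := Num.min (f0 w) (g w).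
have [mf0 [M f0M]] := bf0; have [mg [N gN]] := bg.
have bf : bdd f.
  split; first exact: measurable_minr.
  exists (`|M| + `|N|) => w; have := f0M w; have := gN w; have := ler_norm M;
    have := ler_norm N.
  have := normr_ge0 M; have := normr_ge0 N.
  by rewrite /f; case: (leP (f0 w) (g w)) => _; lra.
have fg w : f w <= g w by rewrite /f ge_min lexx orbT.
have mX : measurable_fun setT X by [].
have mY : measurable_fun setT Y by [].
have Xf : pr P [set w | X w - f w != 0] = 0.
  have m1 : measurable [set w | X w - f0 w != 0] by apply: measurable_neq0;
    exact: measurable_funB.
  have m2 : measurable [set w | Y w - g w != 0] by apply: measurable_neq0;
    exact: measurable_funB.
  apply/le_anti; rewrite pr_ge0 andbT.
  apply: (@le_trans _ _ (pr P ([set w | X w - f0 w != 0] `|` [set w | Y w - g w != 0]))).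
    apply: pr_le; [|exact: measurableU|].
      by apply: measurable_neq0; apply: measurable_funB => //; exact: measurable_minr.
    move=> w /=; rewrite !subr_eq0.
    case: (eqVneq (X w) (f0 w)) => [Xw|]; last by left.
    case: (eqVneq (Y w) (g w)) => [Yw|]; last by right.
    by rewrite /f -Xw -Yw min_l// eqxx.
  by rewrite (le_trans (prU_le _ _ _))// Xf0 Yg addr0.
have [_ -> ->] := Linfty_represented p bf Xf.
have [_ -> ->] := Linfty_represented p bg Yg.
(* ES is raised before the mean: in the other order the intermediate point could leave the
   half-plane. *)
apply: (@le_trans _ _ (F (ESfun P p g) (\int[P]_w f w))).
  by apply: F_first; [exact: Rintegral_le_ESfun|exact: le_ESfun].
apply: F_second; last exact: Rintegral_le_ESfun.
by apply: le_Rintegral => //; exact: bdd_integrable.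
Qed.

End represented.

(** * From concentration aversion to the representation *)

Section averse.
Variable rho : Linfty P -> \bar R.
Hypothesis pca : p_concentration_aversion p rho.
Variables (A0 : set T) (mA0 : measurable A0) (PA0 : pr P A0 = 1 - p).

(** The value on the complement of [A0] that makes the mean equal to [y]. *)
Let low (x y : R) : R := (y - (1 - p) * x) / p.

Definition two_point x y := piecewise A0 (cst x) (cst (low x y)).

Lemma bdd_two_point x y : bdd (two_point x y).
Proof. by apply: bdd_piecewise => //; exact: bdd_cst. Qed.

Lemma rho_fun_two_point g : bdd g ->
  rho_fun rho g = rho_fun rho (two_point (ESfun P p g) (\int[P]_w g w)).
Proof.
move=> bg; have /andP[p0 _] := p01.
have [A [v [mA PA gA gB]]] := exists_separates P_atomless bg p01.
have EA := ESfun_separates p01 mA PA bg (separates_ptw P gA gB).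
have PC : pr P (~` A) = p by rewrite pr_setC// PA; ring.
rewrite (rho_fun_mean P_atomless p01 pca (a := ESfun P p g)
  (b := low (ESfun P p g) (\int[P]_w g w)) mA PA bg gA gB).
(* The tail event [A] depends on [g]; law invariance moves it to the fixed [A0]. *)
- apply: (rho_fun_same_law P_atomless p01 pca).
    by apply: bdd_piecewise => //; exact: bdd_cst.
  by apply: same_law_piecewise_cst => //; rewrite PA.
- by rewrite PA mulrC.
- by rewrite PC /low EA (Rintegral_setC mA bg) divfK ?gt_eqF// addrAC subrr add0r.
Qed.

Lemma represented_by_two_point :
  represented_by p rho (fun x y => rho_fun rho (two_point x y)).
Proof.
move=> X; have [g bg Xg] := Linfty_bdd X.
have [lX -> ->] := Linfty_represented p bg Xg.
by rewrite (rho_funE P_atomless p01 pca lX) rho_fun_two_point.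
Qed.

(* A tail event of [- 1_A0] fills up the complement of [A0] first, hence cannot be [A0]. *)
Lemma exists_opposite_tail : exists (B : set T) (u : R), [/\ measurable B, pr P B = 1 - p,
  pr P (A0 `&` B) < 1 - p,
  (forall w, B w -> u <= - (\1_A0 w : R)) & (forall w, ~ B w -> - (\1_A0 w : R) <= u)].
Proof.
have /andP[p0 _] := p01.
have b1 : bdd (fun w => - \1_A0 w : R) by apply: bddN; exact: bdd_indic.
have [B [u [mB PB h1 h2]]] := exists_separates P_atomless b1 p01.
exists B, u; split => //.
have mAB : measurable (A0 `&` B) by exact: measurableI.
rewrite lt_neqAle -{2}PB pr_le// andbT; apply/eqP => AB.
have [w0 [Aw0 Bw0]] : exists w, A0 w /\ B w.
  apply: contrapT => /forallNP nAB; have := p1.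
  by rewrite -AB (_ : _ `&` _ = set0) ?pr0 ?ltxx//; apply/seteqP; split.
(* A point of [A0] in [B] pushes the threshold down to -1, so the complement of [B] lies in [A0].
   With all the mass of [B] in [A0] as well, [A0] would have probability 1. *)
have u1 : u <= - 1.
  by have := h1 _ Bw0; rewrite indicE (mem_set Aw0).
have BA : ~` B `<=` A0.
  move=> w Bw; apply: contrapT => Aw; have := h2 _ Bw.
  by rewrite indicE (memNset Aw) oppr0; lra.
have mCB := measurableC mB.
have : pr P (A0 `\` B) = p.
  rewrite setDE setIC (setIidl BA) pr_setC// PB; ring.
by have := prDI P mA0 mB; rewrite AB PA0; lra.
Qed.

(** The two-valued variable is split into summands that move against each other on [A0]. Moving the
    second one onto a tail event [B] of the first preserves both laws, hence the mean, and can only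
    raise [rho]. Since [B] meets [A0] in less than its full mass, the cancelling part can be tuned
    to reach any larger ES. *)
Lemma increasing_two_point :
  increasing_in_first (fun x y => rho_fun rho (two_point x y)).
Proof.
move=> x x' y yx xx'; have /andP[p0 _] := p01.
have [B [u [mB PB AB hB hC]]] := exists_opposite_tail.
pose z := low x y; pose k := x - z.
have zE : p * z = y - (1 - p) * x by rewrite /z /low mulrC divfK// gt_eqF.
have k0 : 0 <= k.
  have : 0 <= p * k by rewrite /k mulrBr zE; lra.
  by rewrite pmulr_rge0.
pose beta := pr P (A0 `&` B).
have b1 : 0 < 1 - p - beta by rewrite subr_gt0.
(* [m] makes [x'] the expected shortfall of the concentrated sum
   [(z - m 1_A0) + (k + m) 1_B], while moving [B] to [A0] gives back [two_point x y]. *)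
pose m := (x' - x) * (1 - p) / (1 - p - beta).
have m0 : 0 <= m.
  by apply: divr_ge0; [apply: mulr_ge0; [rewrite subr_ge0|exact: ltW]|exact: ltW].
have mE : m * (1 - p) - m * beta = (x' - x) * (1 - p).
  by rewrite -mulrBr /m divfK// gt_eqF.
pose I (C : set T) : T -> R := \1_C.
have bI C : measurable C -> bdd (I C) by move=> mC; exact: bdd_indic.
pose U w := - m * I A0 w + z.
have bU : bdd U by apply: bddD; [apply: bddZ; exact: bI|exact: bdd_cst].
have bV C : measurable C -> bdd (fun w => (k + m) * I C w).
  by move=> mC; apply: bddZ; exact: bI.
have E1 : two_point x y = fun w => U w + (k + m) * I A0 w.
  apply/funext => w; rewrite /U /I indicE; have [Aw|Aw] := pselect (A0 w).
    by rewrite /two_point piecewiseT// (mem_set Aw) /= /k; ring.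
  by rewrite /two_point piecewiseF// (memNset Aw) /= -/z; ring.
have sU : separates P B (m * u + z) U.
  apply: separates_ptw => w Bw; rewrite /U lerD2r mulNr -mulrN ler_wpM2l//.
    exact: hB.
  exact: hC.
have sV : separates P B (k + m) (fun w => (k + m) * I B w).
  apply: separates_ptw => w Bw; rewrite /I indicE.
    by rewrite (mem_set Bw) mulr1.
  by rewrite (memNset Bw) mulr0 addr_ge0.
have lV : same_law P (fun w => (k + m) * I A0 w) (fun w => (k + m) * I B w).
  have E C : (fun w => (k + m) * I C w) = piecewise C (cst (k + m)) (cst 0).
    apply/funext => w; rewrite /I indicE; have [Cw|Cw] := pselect (C w).
      by rewrite piecewiseT// (mem_set Cw) mulr1.
    by rewrite piecewiseF// (memNset Cw) mulr0.
  by rewrite !E; apply: same_law_piecewise_cst => //; rewrite PA0.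
rewrite E1; apply: (@le_trans _ _ (rho_fun rho (fun w => U w + (k + m) * I B w))).
  by apply: (rho_fun_le P_atomless p01 pca mB PB bU (bV _ mA0) bU (bV _ mB) sU sV).
have bUV : bdd (fun w => U w + (k + m) * I B w) by exact: (bddD bU (bV _ mB)).
rewrite (rho_fun_two_point bUV) le_eqVlt; apply/orP; left; apply/eqP.
have IE C : measurable C -> \int[P]_(w in C) (U w + (k + m) * I B w) =
    - m * pr P (A0 `&` C) + ((k + m) * pr P (B `&` C) + z * pr P C).
  move=> mC; rewrite -(Rintegral_indic_pr mC mA0) -(Rintegral_indic_pr mC mB).
  rewrite -Rintegral_cst_pr// -RintegralZD//; [|exact: bI|exact: bdd_cst].
  rewrite -RintegralZD//; [|exact: bI|]; last first.
    by apply: bddD; [apply: bddZ; exact: bI|exact: bdd_cst].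
  by apply: eq_Rintegral => w _; rewrite /U /I; ring.
congr (rho_fun rho (two_point _ _)).
  apply: (mulfI (lt0r_neq0 p1)).
  have [mU _] := bU; have [mV _] := bV _ mB.
  rewrite (ESfun_separates p01 mB PB bUV (separatesD mB mU mV sU sV)) IE//.
  rewrite setIid PB -/beta.
  have -> : - m * beta + ((k + m) * (1 - p) + z * (1 - p)) =
    (k + z) * (1 - p) + (m * (1 - p) - m * beta) by ring.
  by rewrite mE /k; ring.
rewrite IE// !setIT PA0 PB prT.
have -> : - m * (1 - p) + ((k + m) * (1 - p) + z * 1) = k * (1 - p) + z by ring.
have -> : k * (1 - p) + z = x * (1 - p) + p * z by rewrite /k; ring.
by rewrite zE; ring.
Qed.

Lemma increasing_second_two_point : monotonicity rho ->
  increasing_in_second (fun x y => rho_fun rho (two_point x y)).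
Proof.
move=> mono x y y' yy' _; have /andP[p0 _] := p01.
have [X XE] := bdd_Linfty P (bdd_two_point x y).
have [Y YE] := bdd_Linfty P (bdd_two_point x y').
rewrite -(@rho_funE _ _ _ _ P_atomless _ p01 _ pca X); last first.
  by move=> t; under eq_set do rewrite XE.
rewrite -(@rho_funE _ _ _ _ P_atomless _ p01 _ pca Y); last first.
  by move=> t; under eq_set do rewrite YE.
apply: mono => w; rewrite XE YE /two_point; have [Aw|Aw] := pselect (A0 w).
  by rewrite !piecewiseT.
by rewrite !piecewiseF//= /low ler_pM2r ?invr_gt0// lerD2r.
Qed.

End averse.
End functionals.

Theorem theorem1 (d : measure_display) (T : measurableType d) (R : realType)
    (P : probability T R) (P_atomless : atomless P)
    (p : R) (p01 : 0 < p < 1)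
    (rho : Linfty P -> \bar R) (rho_gtNy : forall X, (-oo < rho X)%E) :
  (p_concentration_aversion p rho <->
   exists f : R -> R -> \bar R,
     [/\ gtNy_on_halfplane f, increasing_in_first f & represented_by p rho f])
  /\
  (monotonicity rho /\ p_concentration_aversion p rho <->
   exists f : R -> R -> \bar R,
     [/\ gtNy_on_halfplane f, increasing_in_first f, increasing_in_second f
       & represented_by p rho f]).
Proof.
have [A0 [mA0 _ PA0]] : exists A, [/\ measurable A, A `<=` setT & pr P A = 1 - p].
  apply: atomless_subset => //; rewrite prT.
  by have /andP[p0 p1] := p01; apply/andP; split; lra.
pose f x y := rho_fun rho (two_point p A0 x y).
have fNy : gtNy_on_halfplane f by move=> x y _; exact: rho_gtNy.
split; split.
- move=> pca; exists f; split => //; first exact: increasing_two_point.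
  exact: represented_by_two_point.
- by move=> [F [_ F1 rF]]; exact: represented_concentration_aversion rF.
- move=> [mono pca]; exists f; split => //; first exact: increasing_two_point.
    exact: increasing_second_two_point.
  exact: represented_by_two_point.
- move=> [F [_ F1 F2 rF]]; split; first exact: represented_monotonicity rF _.
  exact: represented_concentration_aversion rF.
Qed.
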